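(* Let $K$ be a number field with ring of integers $R$, let $\mathfrak{m}$ be a modulus for $K$, and let $\Gamma\subseteq (R/\mathfrak{m})^*$ be a subgroup. The set $\left(\bigsqcup_{\mathfrak{a}\in\mathcal{I}_{\mathfrak{m}}^+}R/\mathfrak{a}\right)\sqcup\{\emptyset\}$ (whose elements are the cosets $x+\mathfrak{a}\subseteq R$ with $x\in R$, $\mathfrak{a}\in\mathcal{I}_{\mathfrak{m}}^+$, together with $\emptyset$) is a semilattice with respect to intersections. For each $x\in R$ and $\mathfrak{a}\in\mathcal{I}_{\mathfrak{m}}^+$, the set $(x+\mathfrak{a})\times(\mathfrak{a}\cap R_{\mathfrak{m},\Gamma})$ is a constructible right ideal of $R\rtimes R_{\mathfrak{m},\Gamma}$, and the map \[ \left(\bigsqcup_{\mathfrak{a}\in\mathcal{I}_{\mathfrak{m}}^+}R/\mathfrak{a}\right)\sqcup\{\emptyset\}\to\mathcal{J}_{R\rtimes R_{\mathfrak{m},\Gamma}} \] given by $x+\mathfrak{a}\mapsto (x+\mathfrak{a})\times(\mathfrak{a}\cap R_{\mathfrak{m},\Gamma})$ and $\emptyset\mapsto\emptyset$ is an isomorphism of semilattices. Moreover, $\mathcal{J}_{R\rtimes R_{\mathfrak{m},\Gamma}}$ is independent.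
   Context: Number-theoretic notation. $R^\times:=R\setminus\{0\}$, $K^\times:=K\setminus\{0\}$; $\mathcal{P}_K$ is the set of non-zero prime ideals of $R$; $V_{K,\mathbb{R}}$ is the set of real embeddings of $K$; $\mathbb{N}$ contains $0$. A modulus $\mathfrak{m}$ for $K$ is a function $\mathfrak{m}:V_{K,\mathbb{R}}\sqcup\mathcal{P}_K\to\mathbb{N}$ such that $\mathfrak{m}_\infty:=\mathfrak{m}|_{V_{K,\mathbb{R}}}$ takes values in $\{0,1\}$ and $\mathfrak{m}(\mathfrak{p})=0$ for all but finitely many $\mathfrak{p}\in\mathcal{P}_K$. Put $\mathfrak{m}_0:=\prod_{\mathfrak{p}}\mathfrak{p}^{\mathfrak{m}(\mathfrak{p})}$, and write $w\mid\mathfrak{m}_\infty$ if $\mathfrak{m}_\infty(w)=1$. $(R/\mathfrak{m})^*:=\prod_{w\mid\mathfrak{m}_\infty}\{\pm1\}\times(R/\mathfrak{m}_0)^*$. $R_{\mathfrak{m}}:=\{a\in R^\times: v_{\mathfrak{p}}(a)=0\text{ for all }\mathfrak{p}\mid\mathfrak{m}_0\}$, and for $a\in R_{\mathfrak{m}}$, $[a]_{\mathfrak{m}}:=((\mathrm{sign}(w(a)))_{w\mid\mathfrak{m}_\infty},a+\mathfrak{m}_0)\in(R/\mathfrak{m})^*$. $R_{\mathfrak{m},\Gamma}:=\{a\in R_{\mathfrak{m}}:[a]_{\mathfrak{m}}\in\Gamma\}$, a multiplicative monoid. $\mathcal{I}_{\mathfrak{m}}^+$ is the monoid of non-zero integral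 ideals of $R$ coprime to $\mathfrak{m}_0$. $R\rtimes R_{\mathfrak{m},\Gamma}$ is the set of pairs $(b,a)$, $b\in R$, $a\in R_{\mathfrak{m},\Gamma}$, with product $(b,a)(d,c)=(b+ad,ac)$. Constructible right ideals. For a unital subsemigroup $P$ of a group $G$, $p\in P$ and $X\subseteq P$, let $pX=\{px:x\in X\}$ and $p^{-1}(X)=\{p^{-1}x\in G:x\in X\}\cap P$. $\mathcal{J}_P$ is the smallest collection of subsets of $P$ containing $\emptyset$ and $P$, closed under $X\mapsto pX$ and $X\mapsto p^{-1}(X)$ for all $p\in P$, and closed under finite intersections. Its members are the constructible right ideals of $P$; it is a semilattice (commutative semigroup of idempotents) under intersection. $\mathcal{J}_P$ is independent if whenever $X,X_1,\dots,X_n\in\mathcal{J}_P$ satisfy $\bigcup_{i=1}^nX_i=X$, then $X=X_i$ for some $i$. Here $P=R\rtimes R_{\mathfrak{m},\Gamma}$ is viewed inside the group $K\rtimes K^\times$. *)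

(* Defs.v *)
From HB Require Import structures.
From mathcomp Require Import all_boot all_order all_algebra all_field.
From mathcomp Require Import all_classical all_reals.

Set Implicit Arguments.
Unset Strict Implicit.
Unset Printing Implicit Defensive.
Import Order.TTheory GRing.Theory Num.Theory.
Local Open Scope ring_scope.
Local Open Scope classical_set_scope.

Definition is_semilattice (T : Type) (S : set T) (op : T -> T -> T) : Prop :=
  [/\ forall x y, S x -> S y -> S (op x y),
      forall x y z, S x -> S y -> S z -> op x (op y z) = op (op x y) z,
      forall x y, S x -> S y -> op x y = op y x
    & forall x, S x -> op x x = x].

Definition semilattice_iso (T U : Type) (S : set T) (opT : T -> T -> T)
    (S' : set U) (opU : U -> U -> U) (f : T -> U) : Prop :=
  set_bij S S' f /\
  forall x y, S x -> S y -> f (opT x y) = opU (f x) (f y).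

Section ConstructibleIdeals.
Variable G : groupType.
Implicit Types (P X : set G) (p : G).

Definition translate p X : set G := [set (p * x)%g | x in X].

Definition pretranslate P p X : set G := [set (p^-1 * x)%g | x in X] `&` P.

Inductive constructible P : set (set G) :=
| constructible_empty : constructible P set0
| constructible_full : constructible P P
| constructible_translate p X :
    P p -> constructible P X -> constructible P (translate p X)
| constructible_pretranslate p X :
    P p -> constructible P X -> constructible P (pretranslate P p X)
| constructible_setI X Y :
    constructible P X -> constructible P Y -> constructible P (X `&` Y).

End ConstructibleIdeals.

(* The family Y_1, ..., Y_n is nonempty: the empty union equals set0, which is
   always constructible, so n = 0 would make independence fail for every P. *)
Definition independent (T : Type) (J : set (set T)) : Prop :=
  forall (n : nat) (X : set T) (Y : 'I_n.+1 -> set T),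
    J X -> (forall i, J (Y i)) -> \bigcup_i Y i = X -> exists i, X = Y i.

Section AffineGroup.
Variable K : fieldType.

Definition nonzero := {a : K | a != 0}.

(* The underlying set of the semidirect product of K by its nonzero elements;
   (b, a) acts on K as the map x |-> b + a x. *)
Definition affine : Type := (K * nonzero)%type.

HB.instance Definition _ := Choice.on affine.

Implicit Types g h : affine.

Definition affine_one : affine := (0, exist _ 1 (oner_neq0 K)).

Definition affine_mul g h : affine :=
  (g.1 + val g.2 * h.1,
   exist _ (val g.2 * val h.2) (mulf_neq0 (valP g.2) (valP h.2))).

Definition affine_inv g : affine :=
  (- ((val g.2)^-1 * g.1), exist _ (val g.2)^-1 (invr_neq0 (valP g.2))).

Lemma affine_eq g h : g.1 = h.1 -> val g.2 = val h.2 -> g = h.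
Proof. by case: g h => [b a] [d c] /= -> /val_inj ->. Qed.

Lemma affine_mulA : associative affine_mul.
Proof.
by move=> g h k; apply: affine_eq => /=; rewrite ?mulrA // mulrDr mulrA addrA.
Qed.

Lemma affine_mul1g : left_id affine_one affine_mul.
Proof. by move=> g; apply: affine_eq => /=; rewrite mul1r ?add0r. Qed.

Lemma affine_mulg1 : right_id affine_one affine_mul.
Proof. by move=> g; apply: affine_eq => /=; rewrite ?mulr0 ?addr0 ?mulr1. Qed.

Lemma affine_mulVg : left_inverse affine_one affine_inv affine_mul.
Proof.
by move=> g; apply: affine_eq => /=; rewrite ?addNr // mulVf ?(valP g.2).
Qed.

Lemma affine_mulgV : right_inverse affine_one affine_inv affine_mul.
Proof.
move=> g; apply: affine_eq => /=; last by rewrite mulfV ?(valP g.2).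
by rewrite mulrN mulrA mulfV ?(valP g.2) // mul1r addrN.
Qed.

HB.instance Definition _ := isGroup.Build affine
  affine_mulA affine_mul1g affine_mulg1 affine_mulVg affine_mulgV.

End AffineGroup.

Section Ideals.
Variable K : fieldExtType rat.
Implicit Types (I J p : set K) (a x : K).

Definition integers : set K := [set a | integralOver (intr : int -> K) a].

(* Ideals are subsets of K contained in the ring of integers. Contrary to
   MathComp's idealr, the whole ring is an ideal. Closure under opposites
   follows from closure under multiplication by -1. *)
Definition is_ideal I : Prop :=
  [/\ I `<=` integers, I 0,
      forall x y, I x -> I y -> I (x + y)
    & forall r x, integers r -> I x -> I (r * x)].

Definition nonzero_ideal I : Prop := is_ideal I /\ I <> [set 0].

Definition prime_ideal p : Prop :=
  [/\ is_ideal p, p <> integers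
    & forall x y, integers x -> integers y -> p (x * y) -> p x \/ p y].

Definition nonzero_primes : set (set K) :=
  [set p | prime_ideal p /\ p <> [set 0]].

Definition ideal_add I J : set K := [set x + y | x in I & y in J].

Definition ideal_mul I J : set K :=
  [set z | exists (n : nat) (x y : 'I_n -> K),
     (forall i, I (x i) /\ J (y i)) /\ z = \sum_(i < n) x i * y i].

Definition ideal_exp I (n : nat) : set K := iter n (ideal_mul I) integers.

Definition ideal_dvd I J : Prop := exists2 C, is_ideal C & J = ideal_mul I C.

Definition coprime_ideals I J : Prop := ideal_add I J = integers.

Definition addcoset x I : set K := [set x + y | y in I].

(* For nonzero integral a, the exponent n exists and is unique; the default
   value 0 of xget is only used at a = 0 or outside the ring of integers. *)
Definition valuation p a : nat :=
  xget 0%N [set n | ideal_exp p n a /\ ~ ideal_exp p n.+1 a].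

End Ideals.

Arguments integers K : clear implicits.
Arguments nonzero_primes K : clear implicits.

Section Moduli.
(* RR is the field of real numbers. *)
Variables (RR : realType) (K : fieldExtType rat).

Definition real_embedding : Type := {rmorphism K -> RR}.

Record modulus := Modulus {
  mod_fun :> real_embedding + nonzero_primes K -> nat;
  mod_infty_le1 : forall w : real_embedding, (mod_fun (inl w) <= 1)%N;
  mod_finite : finite_set [set p : nonzero_primes K | mod_fun (inr p) != 0%N]
}.

Variable m : modulus.

Definition mod_zero : set K :=
  \big[@ideal_mul K/integers K]_(p \in [set: nonzero_primes K])
     ideal_exp (val p) (m (inr p)).

(* The real embeddings w dividing the infinite part of m. *)
Definition mod_infty : Type := {w : real_embedding | m (inl w) == 1%N}.

(* The group (R/m)^* is represented by the subset residue_units of this type: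
   a family of signs, together with a coset of mod_zero seen as a subset
   of K. *)
Definition residue : Type := ((mod_infty -> int) * set K)%type.

Definition residue_units : set residue :=
  [set g | (forall w, g.1 w = 1 \/ g.1 w = -1) /\
     exists a b, [/\ integers K a, integers K b, mod_zero (a * b - 1)
                   & g.2 = addcoset a mod_zero]].

Definition residue_one : residue := (fun=> 1, addcoset 1 mod_zero).

(* The set of all x y + z, with x and y in two cosets of mod_zero and z in
   mod_zero, is the product coset. *)
Definition coset_mul (c d : set K) : set K :=
  [set u + z | u in [set x * y | x in c & y in d] & z in mod_zero].

Definition residue_mul (g h : residue) : residue :=
  (fun w => g.1 w * h.1 w, coset_mul g.2 h.2).

Definition residue_subgroup (Gamma : set residue) : Prop :=
  [/\ Gamma `<=` residue_units, Gamma residue_one,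
      forall g h, Gamma g -> Gamma h -> Gamma (residue_mul g h)
    & forall g, Gamma g -> exists2 h, Gamma h & residue_mul g h = residue_one].

Definition residue_class (a : K) : residue :=
  (fun w : mod_infty => sgz (sval w a), addcoset a mod_zero).

Definition R_mod : set K :=
  [set a | [/\ integers K a, a != 0
     & forall p : nonzero_primes K,
         ideal_dvd (val p) mod_zero -> valuation (val p) a = 0%N]].

Definition R_modGamma (Gamma : set residue) : set K :=
  [set a | R_mod a /\ Gamma (residue_class a)].

Definition coprime_integral_ideals : set (set K) :=
  [set I | nonzero_ideal I /\ coprime_ideals I mod_zero].

Definition cosets_or_empty : set (set K) :=
  [set C | C = set0 \/
     exists x I, [/\ integers K x, coprime_integral_ideals I & C = addcoset x I]].

Definition R_rtimes_R_modGamma (Gamma : set residue) : set (affine K) :=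
  [set g | integers K g.1 /\ R_modGamma Gamma (val g.2)].

Definition coset_rtimes (Gamma : set residue) (x : K) (I : set K) :
    set (affine K) :=
  [set g | addcoset x I g.1 /\ (I `&` R_modGamma Gamma) (val g.2)].

End Moduli.

(* Main.v *)
Require Import Defs.
From mathcomp Require Import all_boot all_order all_algebra all_field.
From mathcomp Require Import all_classical all_reals.
From mathcomp Require Import ring lra.

(** Write [R] for the ring of integers, [m0] for the finite part of the modulus,
    [S] for the monoid of integers with class in [Gamma], and [P] for the
    semigroup of pairs [(b, a)] with [b] in [R] and [a] in [S].

    The easy half is that the sets [(x + I) * (I & S)], with [I] coprime to
    [m0], and the empty set are stable under all the operations generating the
    constructible ideals ([constructible_coset]): translation by [(b, a)]
    replaces [x + I] by [b + a x + a I], pretranslation replaces [I] by the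
    quotient [(I : a)], and an intersection of two cosets is empty or a coset of
    the intersection of the ideals. This uses that [a] in [S] is a unit modulo
    [m0] ([R_modE]) and that [a b] and [a] in [S] force [b] in [S].

    For the converse, [I] has to be obtained from [R] by these operations.
    Choose [d] in [I] and [S] that is [1] modulo [m0]. As [I] is invertible, it
    is the set of [x] with [x J] in [d R], where [J] is [d] times the inverse of
    [I]. Finitely many [c] in [J] are enough to test this, and they can be moved
    into [S] by adding elements of [d R] ([ideal_divisorial]); then [I] is a
    finite intersection of the ideals [{x | c x in d R}], which correspond to
    the pretranslates by [(0, c)] of the translates by [(0, d)] of [P].

    For independence, suppose that [x + I] is the union of members with ideals
    [I_i] strictly inside [I]. By invertibility, [I_i] lies in [I p_i] with
    [p_i] maximal ([proper_sub_mul_maximal]). By a prime avoidance argument some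
    [a] in [I] and [S] is outside all the [I p_i] ([avoid_maximal]), so that the
    point [(x, a)] is not covered. Elements of [S] are found as
    follows: an integer that is [1] modulo [m0] becomes positive at all real
    embeddings after adding a suitable multiple of any given positive integer in
    [m0] ([R_modGamma_shift]).

    What remains is the invertibility of nonzero ideals. It rests on one
    finiteness property: the quotient of [R] by a positive integer is finite
    ([finite_mod_nat]), because elements of [R] whose classes modulo a prime
    number are linearly independent are themselves independent over the
    rationals. By the pigeonhole principle, [R] is then completely integrally
    closed ([almost_integral]), and ideals containing a given positive integer
    satisfy the maximum principle. Maximal annihilators give, for every proper
    nonzero ideal [A], some [v] outside [R] with [v A] in [R]; applied to the
    product of [I] and its inverse, this contradicts complete integral
    closedness unless the product is [R] ([ideal_invertible]). *)

Set Implicit Arguments.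
Unset Strict Implicit.
Unset Printing Implicit Defensive.
Import Order.TTheory GRing.Theory Num.Theory.
Local Open Scope ring_scope.
Local Open Scope classical_set_scope.

(** * The ring of integers *)

Section IntegerRing.
Variable K : fieldExtType rat.
Implicit Types (x y a b : K).
Local Notation R := (integers K).

Lemma integers0 : R 0. Proof. exact: integral0. Qed.
Lemma integers1 : R 1. Proof. exact: integral1. Qed.
Lemma integers_nat n : R n%:R. Proof. exact: integral_nat. Qed.
Lemma integersD x y : R x -> R y -> R (x + y). Proof. exact: integral_add. Qed.
Lemma integersN x : R x -> R (- x). Proof. exact: integral_opp. Qed.
Lemma integersB x y : R x -> R y -> R (x - y). Proof. exact: integral_sub. Qed.
Lemma integersM x y : R x -> R y -> R (x * y). Proof. exact: integral_mul. Qed.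

Lemma integers_int (n : int) : R n%:~R.
Proof. by case: n => n; [|rewrite NegzE mulrNz; apply: integersN];
  apply: integers_nat. Qed.

Lemma integersX x n : R x -> R (x ^+ n).
Proof.
by move=> Rx; elim: n => [|n IH]; [exact: integers1|rewrite exprS;
  apply: integersM].
Qed.

Lemma integers_sum (I : Type) (r : seq I) (F : I -> K) :
  (forall i, R (F i)) -> R (\sum_(i <- r) F i).
Proof. by move=> RF; elim/big_ind: _ => // *;
  [exact: integers0|exact: integersD]. Qed.

Lemma natK_neq0 n : (n%:R != 0 :> K) = (n != 0)%N.
Proof.
have -> : n%:R = in_alg K n%:R by rewrite rmorph_nat.
by rewrite fmorph_eq0 pnatr_eq0.
Qed.

(** The constant coefficient of a monic integral equation of [a], after
    division by the largest possible power of the variable. *)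
Lemma integers_dvd_nat a : R a -> a != 0 ->
  exists2 N : nat, (0 < N)%N & exists2 b, R b & N%:R = a * b.
Proof.
move=> Ra a0; case: (Ra) => p.
elim/poly_ind: p => [|q c IH]; first
  by rewrite monicE lead_coef0 eq_sym oner_eq0.
have Rq : R (map_poly intr q).[a].
  by apply: integral_horner => //; apply/integral_poly => i; rewrite coef_map;
    exact: integers_int.
have [-> | c0] := eqVneq c 0.
  rewrite addr0 monicMr ?monicX // => mq; rewrite rmorphM /= map_polyX.
  rewrite rootE hornerM hornerX mulf_eq0 (negPf a0) orbF; exact: IH.
move=> _; rewrite rootE rmorphD rmorphM /= map_polyX map_polyC !hornerE =>
  /eqP e.
exists `|c|%N; first by rewrite absz_gt0.
have e' : a * (map_poly intr q).[a] = - c%:~R by apply/eqP;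
  rewrite -subr_eq0 opprK mulrC e.
have [c_ge | c_lt] := lerP 0 c.
  exists (- (map_poly intr q).[a]); first exact: integersN.
  by rewrite mulrN e' opprK -[in RHS](gez0_abs c_ge).
exists (map_poly intr q).[a] => //.
by rewrite e' -[in RHS](opprK c) -(ltz0_abs c_lt) mulrNz opprK.
Qed.

(** * Finiteness of the quotients by integers *)

Definition finite_mod (N : nat) := exists2 s : seq K, {in s, forall r, R r} &
  forall x, R x -> exists2 r, r \in s & exists2 y, R y & x = r + N%:R * y.

Lemma finite_modM M N : finite_mod M -> finite_mod N -> finite_mod (M * N).
Proof.
move=> [s Rs s_all] [t Rt t_all].
exists [seq r + M%:R * q | r <- s, q <- t].
  move=> _ /allpairsP [[r q] /= [rs qt ->]].
  by apply: integersD; [exact: Rs|apply: integersM;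
    [exact: integers_nat|exact: Rt]].
move=> x /s_all [r rs [y /t_all [q qt [z Rz ->]] ->]].
exists (r + M%:R * q); first by apply/allpairsP; exists (r, q).
by exists z => //; rewrite mulrDr addrA natrM mulrA.
Qed.

(** Independence of residue classes modulo [l], stated for lifts. *)
Definition free_mod (l : nat) k (x : 'I_k -> K) := forall c : 'I_k -> int,
  (exists2 y, R y & \sum_i (c i)%:~R * x i = l%:R * y) ->
  forall i, (l%:Z %| c i)%Z.

(** A rational relation can be scaled to an integral one; dividing by [l]
    repeatedly shows that its coefficients are divisible by all powers
    of [l]. *)
Lemma free_mod_le_dim l k (x : 'I_k -> K) :
  prime l -> free_mod l x -> (k <= \dim {:K})%N.
Proof.
move=> pl fx.
have l0 : l%:R != 0 :> K by rewrite natK_neq0 -lt0n prime_gt0.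
have relZ (c : 'I_k -> int) : \sum_i (c i)%:~R * x i = 0 -> forall i, c i = 0.
  have descent e : forall c : 'I_k -> int, \sum_i (c i)%:~R * x i = 0 ->
      forall i, ((l ^ e)%N%:Z %| c i)%Z.
    elim: e => [|e IH] {}c sc i; first by rewrite dvdzE.
    have lc : forall i, (l%:Z %| c i)%Z.
      by apply: fx; exists 0; [exact: integers0|rewrite sc mulr0].
    have /IH/(_ i) : \sum_i ((c i %/ l)%Z)%:~R * x i = 0.
      apply: (mulfI l0); rewrite mulr_sumr mulr0 -[RHS]sc;
        apply: eq_bigr => j _.
      rewrite mulrA; congr (_ * _); rewrite -[in RHS](divzK (lc j)) rmorphM /=.
      by rewrite mulrC.
    rewrite expnSr PoszM => /dvdzP [q e1].
    by apply/dvdzP; exists q; rewrite -[LHS](divzK (lc i)) e1 mulrA.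
  move=> sc i; apply/eqP; rewrite -absz_eq0; apply/negPn/negP;
    rewrite -lt0n => c_gt0.
  have := descent `|c i|%N c sc i; rewrite dvdzE /= => /(dvdn_leq c_gt0).
  by rewrite leqNgt ltn_expl // prime_gt1.
have /eqnP : free [tuple x i | i < k].
  apply/freeP => q sq.
  pose D := \prod_i denq (q i).
  have D0 : D != 0 by apply/prodf_neq0 => i _; exact: denq_neq0.
  pose c i := numq (q i) * \prod_(j | j != i) denq (q j).
  have cE i : (c i)%:~R = D%:~R * q i :> rat.
    by rewrite /D (bigD1 i) //= !rmorphM /= numqE; ring.
  have /relZ c0 : \sum_i (c i)%:~R * x i = 0.
    have := congr1 ( *:%R D%:~R) sq; rewrite scaler0 scaler_sumr => e;
      rewrite -[RHS]e.
    apply: eq_bigr => i _; rewrite scalerA -cE.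
    rewrite -tnth_nth tnth_mktuple -[in RHS](mulr_algl _ (x i)).
    by congr (_ * _); rewrite -[LHS](rmorph_int (in_alg K)).
  move=> i; have := cE i; rewrite c0 => /esym/eqP; rewrite mulf_eq0 intr_eq0.
  by rewrite (negPf D0) => /eqP.
by rewrite size_tuple => <-; apply: dimvS; exact: subvf.
Qed.

(** A family with [free_mod] of maximal length spans [R] modulo [l]: its length
    is bounded by the degree, and a relation produced by adding [y] to it has a
    coefficient of [y] that is invertible modulo [l]. *)
Lemma finite_mod_prime l : prime l -> finite_mod l.
Proof.
move=> pl.
pose P k := `[< exists2 x : 'I_k -> K, forall i, R (x i) & free_mod l x >].
have exP : exists k, P k by exists 0%N; apply/asboolP;
  exists (fun=> 0) => [|c _] [].
have leP k : P k -> (k <= \dim {:K})%N by move=> /asboolP[x _];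
  exact: free_mod_le_dim.
have [k /asboolP[x Rx fx] kmax] := ex_maxnP exP leP.
exists [seq \sum_(i < k) (c i)%:R * x i | c : {ffun 'I_k -> 'I_l}].
  by move=> _ /mapP[c _ ->]; apply: integers_sum => i; apply: integersM => //;
    exact: integers_nat.
move=> y Ry.
(* By maximality, adding [y] to the family produces a relation. *)
pose xy (i : 'I_k.+1) := if unlift ord_max i is Some j then x j else y.
have [c [z Rz sc] [i0 ci0]] : exists2 c : 'I_k.+1 -> int,
    (exists2 z, R z & \sum_i (c i)%:~R * xy i = l%:R * z) &
    exists i, ~~ (l%:Z %| c i)%Z.
  apply: contrapT => nc; suff /kmax : P k.+1 by rewrite ltnn.
  apply/asboolP; exists xy => [i|c cz i]; first by rewrite /xy; case: unlift.
  by apply: contrapT => /negP nci; apply: nc; exists c => //; exists i.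
rewrite big_ord_recr /= {2}/xy unlift_none in sc.
have {}sc : \sum_(i < k) (c (widen_ord (leqnSn k) i))%:~R * x i +
    (c ord_max)%:~R * y = l%:R * z.
  rewrite -sc; congr (_ + _); apply: eq_bigr => i _; congr (_ * _).
  have -> : widen_ord (leqnSn k) i = lift ord_max i by apply: ord_inj;
    rewrite lift_max.
  by rewrite /xy liftK.
pose d := c ord_max; pose c' i := c (widen_ord (leqnSn k) i).
(* Otherwise the relation would be one between the [x i] modulo [l]. *)
have ld : coprimez l d.
  rewrite /coprimez /= /gcdz eqz_nat -/(coprime _ _) prime_coprime //.
  apply: contra ci0 => ldc; move: (ldc); rewrite -[(_ %| _)%N]/((l%:Z %| d)%Z)
    => /dvdzP [e de].
  have lc' : forall i, (l%:Z %| c' i)%Z.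
    apply: fx; exists (z - e%:~R * y); first by apply/integersB/integersM =>
      //; exact: integers_int.
    by rewrite mulrBr -sc -/d de rmorphM /=; ring.
  case: (unliftP ord_max i0) => [j ->|->] //.
  have -> : lift ord_max j = widen_ord (leqnSn k) j by apply: ord_inj;
    rewrite lift_max.
  exact: lc'.
have [u [v uv]] : exists u v, u * l%:Z + v * d = 1.
  by have [u [v e]] := Bezoutz l d; exists u, v; rewrite e; exact/eqP.
have l0 : l%:Z != 0 by rewrite -lt0n prime_gt0.
(* The coordinates of [y] modulo [l], before their reduction. *)
pose e i := (- v * c' i)%R.
have eE i : (e i)%:~R = (`|(e i %% l)%Z|%N)%:R + l%:R * ((e i %/ l)%Z)%:~R :> K.
  rewrite -[LHS]/((e i)%:~R) {1}(divz_eq (e i) l) addrC rmorphD rmorphM /=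
    mulrC; congr (_ + _).
  by rewrite -[RHS]/(`|(e i %% l)%Z|%N%:Z%:~R) gez0_abs // modz_ge0.
have lt_l i : (`|(e i %% l)%Z| < l)%N.
  by rewrite -ltz_nat gez0_abs ?modz_ge0 // ltz_pmod // ltz_nat prime_gt0.
exists (\sum_(i < k) (`|(e i %% l)%Z|%N)%:R * x i).
  apply/mapP; exists [ffun i => Ordinal (lt_l i)]; first by rewrite mem_enum.
  by apply: eq_bigr => i _; rewrite ffunE.
exists (\sum_(i < k) ((e i %/ l)%Z)%:~R * x i + v%:~R * z + u%:~R * y).
  apply: integersD; last by apply: integersM => //; exact: integers_int.
  apply: integersD; last by apply: integersM => //; exact: integers_int.
  by apply: integers_sum => i; apply: integersM => //; exact: integers_int.
transitivity ((u * l%:Z + v * d)%:~R * y); first by rewrite uv mul1r.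
transitivity (\sum_(i < k) (e i)%:~R * x i + l%:R * (v%:~R * z + u%:~R * y)).
  have -> : \sum_(i < k) (e i)%:~R * x i =
      - v%:~R * \sum_(i < k) (c' i)%:~R * x i.
    by rewrite mulr_sumr; apply: eq_bigr => i _;
      rewrite /e rmorphM rmorphN /= mulrA.
  by rewrite mulrDr [l%:R * (v%:~R * z)]mulrCA -sc -/d rmorphD !rmorphM /=;
    ring.
rewrite -[X in _ = _ + _ * X]addrA [X in _ =
  _ + X]mulrDr [RHS]addrA mulr_sumr -big_split /=; congr (_ + _).
by apply: eq_bigr => i _; rewrite eE; ring.
Qed.

Lemma finite_mod_nat N : (0 < N)%N -> finite_mod N.
Proof.
elim/ltn_ind: N => N IH N0.
have [N1 | N1] := leqP N 1.
  have -> : N = 1%N by apply/eqP; rewrite eqn_leq N1.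
  exists [:: 0] => [_ /[!inE] /eqP ->|x Rx]; first exact: integers0.
  by exists 0; rewrite ?inE //; exists x; rewrite // add0r mul1r.
have pN := pdiv_prime N1.
rewrite -(divnK (pdiv_dvd N)); apply: finite_modM; last exact: finite_mod_prime.
have [p_gt1 p_gt0] := (prime_gt1 pN, prime_gt0 pN).
apply: (IH (N %/ pdiv N)%N); first exact: ltn_Pdiv.
rewrite divn_gt0 //; apply: dvdn_leq => //; exact: pdiv_dvd.
Qed.

End IntegerRing.

Section Dedekind.
Variable K : fieldExtType rat.
Implicit Types (x y a b : K) (I J A p : set K).
Local Notation R := (integers K).

Lemma pigeonhole_mod N (u : nat -> K) : (0 < N)%N -> (forall i, R (u i)) ->
  exists i j, (i < j)%N /\ exists2 y, R y & u j - u i = N%:R * y.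
Proof.
move=> /(@finite_mod_nat K)[s Rs s_all] Ru.
have /choice [f fP] : forall i, exists r, r \in s /\ exists2 y, R y & u i =
  r + N%:R * y.
  by move=> i; have [r rs ?] := s_all _ (Ru i); exists r.
have : ~~ uniq [seq f i | i <- iota 0 (size s).+1].
  apply/negP => /uniq_leq_size uf.
  suff /uf : {subset [seq f i | i <- iota 0 (size s).+1] <= s}
    by rewrite size_map size_iota ltnn.
  by move=> _ /mapP[i _ ->]; have [] := fP i.
case/(uniqPn 0) => i [j []]; rewrite size_map size_iota => ij js.
rewrite !(nth_map 0%N) ?size_iota ?(ltn_trans ij) // !nth_iota ?(ltn_trans ij)
  // !add0n => fij.
exists i, j; split=> //.
have [[_ [y Ry ->]] [_ [z Rz ->]]] := (fP j, fP i).
by exists (y - z); [exact: integersB|rewrite fij; ring].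
Qed.

(** For a positive integer [N] divisible by [b], two of the integers [N x ^ k]
    agree modulo [N], which makes [x] a root of a monic trinomial over [R]. *)
Lemma almost_integral b x : b != 0 -> (forall k, R (b * x ^+ k)) -> R x.
Proof.
move=> b0 bx; have Rb : R b by have := bx 0%N; rewrite mulr1.
have [N N0 [c Rc Nbc]] := integers_dvd_nat Rb b0.
have [|i [j [ij [y Ry e]]]] := @pigeonhole_mod N (fun k => N%:R * x ^+ k) N0.
  by move=> k; rewrite Nbc mulrAC mulrC; apply: integersM.
have {}e : x ^+ j - x ^+ i = y.
  by apply: (@mulfI _ N%:R); rewrite ?natK_neq0 -?lt0n // -e mulrBr.
have szq : (size (- 'X^i - y%:P : {poly K})%R < j.+1)%N.
  rewrite ltnS; apply: leq_trans (size_polyD _ _) _.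
  by rewrite geq_max !size_polyN size_polyXn ij (leq_trans (size_polyC_leq1 _))
    // (leq_trans _ ij).
apply: (@integral_root_monic int K intr x ('X^j + (- 'X^i - y%:P))).
- by rewrite monicE lead_coefDl ?size_polyXn // lead_coefXn.
- by rewrite rootE !hornerE -e; apply/eqP/subrr.
apply/integral_poly => k; rewrite !coefE.
by apply: integersD; [|apply: integersB => //;
  [apply: integersN|case: ifP => _ //]];
  [exact: integers_nat|exact: integers_nat|exact: integers0].
Qed.

(** * Ideals *)

Lemma idealN I x : is_ideal I -> I x -> I (- x).
Proof.
by case=> _ _ _ IM Ix; rewrite -mulN1r; apply: IM => //; apply: integersN;
  exact: integers1.
Qed.

Lemma idealB I x y : is_ideal I -> I x -> I y -> I (x - y).
Proof. by move=> iI Ix Iy; case: (iI) => _ _ ID _; apply: ID => //;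
  exact: idealN. Qed.

Lemma integers_ideal : is_ideal R.
Proof.
by split=> [//||x y|r x]; [exact: integers0|exact: integersD|exact: integersM].
Qed.

Lemma ideal1_eq I : is_ideal I -> I 1 -> I = R.
Proof.
by move=> [IR _ _ IM] I1; apply/seteqP; split=> // x Rx; rewrite -[x]mulr1;
  exact: IM.
Qed.

Lemma nonzero_idealI I x : is_ideal I -> I x -> x != 0 -> nonzero_ideal I.
Proof. by move=> iI Ix /eqP x0; split=> // I0; apply: x0; move: Ix;
  rewrite I0. Qed.

Lemma nonzero_ideal_nat I : nonzero_ideal I -> exists2 N, (0 < N)%N & I N%:R.
Proof.
move=> [[IR I0 _ IM] nI].
have [a [Ia a0]] : exists a, I a /\ a != 0.
  apply: contrapT => na; apply: nI; apply/seteqP; split=> [x Ix|_ ->] //=.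
  by apply: contrapT => /eqP x0; apply: na; exists x.
have [N N0 [b Rb Nab]] := integers_dvd_nat (IR _ Ia) a0.
by exists N => //; rewrite Nab mulrC; apply: IM.
Qed.

Lemma setI_ideal I J : is_ideal I -> is_ideal J -> is_ideal (I `&` J).
Proof.
move=> [IR I0 ID IM] [JR J0 JD JM]; split=>
  // [x [/IR]|x y [Ix Jx] [Iy Jy]|r x Rr [Ix Jx]] //.
  by split; [exact: ID|exact: JD].
by split; [exact: IM|exact: JM].
Qed.

Lemma ideal_mul_in I J x y : I x -> J y -> ideal_mul I J (x * y).
Proof.
by move=> Ix Jy; exists 1%N, (fun=> x), (fun=> y); split=> //; rewrite big_ord1.
Qed.

Lemma ideal_mul0 I J : ideal_mul I J 0.
Proof. by exists 0%N, (fun=> 0), (fun=> 0); split; [case|rewrite big_ord0]. Qed.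

Lemma ideal_mulD I J x y :
  ideal_mul I J x -> ideal_mul I J y -> ideal_mul I J (x + y).
Proof.
move=> [n [u [v [uv ->]]]] [m [u' [v' [uv' ->]]]].
exists (n + m)%N,
  (fun i : 'I_(n + m) =>
     match fintype.split i with inl j => u j | inr j => u' j end),
  (fun i : 'I_(n + m) =>
     match fintype.split i with inl j => v j | inr j => v' j end).
split=> [i|]; first by case: fintype.split.
rewrite big_split_ord /=; congr (_ + _); apply: eq_bigr => i _.
  by case: split_ordP => j /eqP; rewrite ?eq_lshift ?eq_lrshift // => /eqP ->.
by case: split_ordP => j /eqP; rewrite ?eq_rshift ?eq_rlshift // => /eqP ->.
Qed.

Lemma ideal_mul_ind I J (P : K -> Prop) : P 0 ->
  (forall x y, P x -> P y -> P (x + y)) ->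
  (forall x y, I x -> J y -> P (x * y)) ->
  forall z, ideal_mul I J z -> P z.
Proof.
move=> P0 PD PM z [n [x [y [xy ->]]]]; elim/big_ind: _ => // i _.
by have [] := xy i; exact: PM.
Qed.

(** Only the first factor has to be a module, and only the products have to be
    integral, so that this applies to fractional ideals too. *)
Lemma ideal_mul_ideal I J :
  (forall x y, I x -> J y -> R (x * y)) ->
  (forall r x, R r -> I x -> I (r * x)) -> is_ideal (ideal_mul I J).
Proof.
move=> RIJ IM; split=> [z||x y|r x Rr].
- by elim/ideal_mul_ind: z / => //; [exact: integers0|exact: integersD].
- exact: ideal_mul0.
- exact: ideal_mulD.
elim/ideal_mul_ind: x / => [|x y|x y Ix Jy].
- by rewrite mulr0; exact: ideal_mul0.
- by rewrite mulrDr; exact: ideal_mulD.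
- by rewrite mulrA; apply: ideal_mul_in => //; exact: IM.
Qed.

Lemma mul_ideal I J : is_ideal I -> is_ideal J -> is_ideal (ideal_mul I J).
Proof.
move=> [IR _ _ IM] [JR _ _ _]; apply: ideal_mul_ideal => // x y /IR ? /JR ?.
exact: integersM.
Qed.

Lemma nonzero_mul_ideal I J :
  nonzero_ideal I -> nonzero_ideal J -> nonzero_ideal (ideal_mul I J).
Proof.
move=> nI nJ; have [[N N0 IN] [M M0 JM]] :=
  (nonzero_ideal_nat nI, nonzero_ideal_nat nJ).
apply: (nonzero_idealI _ (ideal_mul_in IN JM)).
  by apply: mul_ideal; [case: nI|case: nJ].
by rewrite mulf_neq0 // natK_neq0 -lt0n.
Qed.

Lemma ideal_mul_subl I J : is_ideal I -> is_ideal J -> ideal_mul I J `<=` I.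
Proof.
move=> [IR I0 ID IM] [JR _ _ _] z; elim/ideal_mul_ind: z / => // x y Ix /JR Ry.
by rewrite mulrC; exact: IM.
Qed.

Lemma ideal_mul_subr I J : is_ideal I -> is_ideal J -> ideal_mul I J `<=` J.
Proof.
move=> [IR _ _ _] [JR J0 JD JM] z; elim/ideal_mul_ind: z / => // x y /IR Rx Jy.
exact: JM.
Qed.

Definition scale_ideal d I : set K := [set d * r | r in I].
Local Notation principal d := (scale_ideal d R).

Lemma scale_ideal_ideal d I : R d -> is_ideal I -> is_ideal (scale_ideal d I).
Proof.
move=> Rd [IR I0 ID IM]; split.
- by move=> _ [r /IR Rr <-]; exact: integersM.
- by exists 0; rewrite ?mulr0.
- by move=> _ _ [r Ir <-] [s Is <-]; exists (r + s); [exact: ID|rewrite mulrDr].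
- by move=> t _ Rt [r Ir <-]; exists (t * r); [exact: IM|rewrite mulrCA].
Qed.

(** * Maximal ideals *)

(** An ideal containing [N] is determined by the elements that it contains of a
    finite system of representatives modulo [N]; take one with the largest
    number of them. *)
Lemma exists_maximal_member N (F : set (set K)) I0 : (0 < N)%N -> F I0 ->
  (forall I, F I -> is_ideal I /\ I N%:R) ->
  exists2 I, F I & forall J, F J -> I `<=` J -> J `<=` I.
Proof.
move=> /(@finite_mod_nat K)[s Rs s_all] FI0 FN.
pose mu I := count (fun r => `[< I r >]) s.
have exP : exists n, `[< exists2 I, F I & mu I = n >].
  by exists (mu I0); apply/asboolP; exists I0.
have leP n : `[< exists2 I, F I & mu I = n >] -> (n <= size s)%N.
  by move=> /asboolP[I _ <-]; exact: count_size.
have [n /asboolP[I FI muI] nmax] := ex_maxnP exP leP.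
exists I => // J FJ IJ x Jx.
have [[[IR _ ID IM] IN] [iJ JN]] := (FN _ FI, FN _ FJ).
have Rx : R x by case: (iJ) => JR _ _ _; exact: JR.
have [r rs [y Ry xE]] := s_all x Rx.
have Jr : J r.
  have -> : r = x - y * N%:R by rewrite xE; ring.
  by apply: idealB => //; case: iJ => _ _ _; apply.
suff Ir : I r by rewrite xE mulrC; apply: ID => //; exact: IM.
apply: contrapT => nIr.
have : (mu J <= mu I)%N by rewrite muI; apply: nmax; apply/asboolP; exists J.
pose b r := `[< J r >] && ~~ `[< I r >].
have -> : mu J = (mu I + count b s)%N.
  rewrite /mu -count_predUI (@eq_count _ (predI _ b) pred0); last first.
    by move=> t /=; rewrite /b; case: `[< I t >]; rewrite //= andbF.
  rewrite count_pred0 addn0; apply: eq_count => t /=; rewrite /b.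
  by case: (asboolP (I t)) => [/IJ/asboolP ->|_]; rewrite ?andbT.
rewrite -[X in (_ <= X)%N]addn0 leq_add2l leqn0 => /eqP/eqP.
by rewrite -leqn0 leqNgt -has_count => /hasP; apply; exists r => //;
  rewrite /b asboolT //= asboolF.
Qed.

(** Maximality is encoded as the existence of inverses modulo [p], the form in
    which it is applied. *)
Definition maximal_ideal p := [/\ nonzero_ideal p, ~ p 1 &
  forall a, R a -> ~ p a -> exists2 b, R b & p (a * b - 1)].

Lemma exists_maximal_ideal A : nonzero_ideal A -> ~ A 1 ->
  exists2 p, maximal_ideal p & A `<=` p.
Proof.
move=> nA A1; have [N N0 AN] := nonzero_ideal_nat nA.
have [|I FI|p [ip Ap np1] pmax] :=
  @exists_maximal_member N [set I | [/\ is_ideal I, A `<=` I & ~ I 1]] A N0.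
- by split=> //; case: nA.
- by case: FI => iI AI _; split=> //; exact: AI.
exists p => //; split=> //.
  by apply: (nonzero_idealI ip (Ap _ AN)); rewrite natK_neq0 -lt0n.
move=> a Ra npa; case: (ip) => pR p0 pD pM.
(* [J] is the ideal generated by [p] and [a]. *)
pose J := [set x | exists2 b, R b & p (a * b - x)].
have pJ : p `<=` J.
  by move=> x px; exists 0; [exact: integers0|rewrite mulr0 sub0r;
    exact: idealN].
have iJ : is_ideal J.
  split=> [x [b Rb /pR pb]||x y [b Rb pb] [c Rc pc]|r x Rr [b Rb pb]].
  - have -> : x = a * b - (a * b - x) by ring.
    by apply: integersB => //; exact: integersM.
  - exact: pJ.
  - exists (b + c); first exact: integersD.
    have -> : a * (b + c) - (x + y) = (a * b - x) + (a * c - y) by ring.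
    exact: pD.
  - exists (r * b); first exact: integersM.
    have -> : a * (r * b) - r * x = r * (a * b - x) by ring.
    exact: pM.
apply: contrapT => nJ1; apply: npa; apply: (pmax J) => //.
  by split=> //; exact: subset_trans pJ.
by exists 1; [exact: integers1|rewrite mulr1 subrr].
Qed.

(** Modulo a positive integer of [p], the powers of [a] repeat, and a power of
    [a] can be cancelled modulo [p]. *)
Lemma prime_maximal p : prime_ideal p -> p <> [set 0] -> maximal_ideal p.
Proof.
move=> [ip pR pprime] p0; have np : nonzero_ideal p by [].
split=> // [p1|a Ra pa]; first exact/pR/ideal1_eq.
have [N N0 pN] := nonzero_ideal_nat np.
have [|i [j [ij [y Ry e]]]] := @pigeonhole_mod N (fun k => a ^+ k) N0.
  by move=> k; exact: integersX.
have pX k : ~ p (a ^+ k).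
  elim: k => [|k IH]; first by rewrite expr0 => /(ideal1_eq ip).
  by rewrite exprS => /pprime[] //; exact: integersX.
exists (a ^+ (j - i).-1); first exact: integersX.
rewrite -exprS prednK ?subn_gt0 //.
have : p (a ^+ i * (a ^+ (j - i) - 1)).
  rewrite mulrBr mulr1 -exprD subnKC 1?ltnW // e mulrC.
  by case: ip => _ _ _; apply.
case/pprime => [||/pX //|//]; first exact: integersX.
by apply: integersB; [exact: integersX|exact: integers1].
Qed.

Lemma maximal_prime p x y : maximal_ideal p -> R x -> R y ->
  p (x * y) -> ~ p x -> p y.
Proof.
move=> [[ip _] _ pmax] Rx Ry pxy /(pmax _ Rx)[b Rb pb].
have -> : y = b * (x * y) - y * (x * b - 1) by ring.
by case: (ip) => _ _ _ pM; apply: idealB => //; exact: pM.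
Qed.

(** Among the elements [b] whose annihilator modulo [N] lies in [p], one with a
    maximal annihilator is annihilated by the whole of [p]: multiplying it by
    an element of [p] outside the annihilator, or by one outside [p], would
    not change the annihilator. *)
Lemma maximal_annihilator p N : maximal_ideal p -> (0 < N)%N -> p N%:R ->
  exists b, [/\ R b, ~ principal N%:R b & forall x, p x ->
    principal N%:R (b * x)].
Proof.
move=> mp N0 pN; case: (mp) => -[ip _] p1 _; case: (ip) => pR _ pD pM.
have iN : is_ideal (principal N%:R) by apply: scale_ideal_ideal;
  [exact: integers_nat|exact: integers_ideal].
case: (iN) => NR N00 ND NM.
pose ann b := [set x | R x /\ principal N%:R (b * x)].
have iann b : R b -> is_ideal (ann b).
  move=> Rb; split=> [x []//||x y [Rx Nx] [Ry Ny]|r x Rr [Rx Nx]].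
  - by split; [exact: integers0|rewrite mulr0].
  - by split; [exact: integersD|rewrite mulrDr; exact: ND].
  - by split; [exact: integersM|rewrite mulrCA; exact: NM].
have annM b c : R c -> ann b `<=` ann (b * c).
  by move=> Rc x [Rx Nx]; split=> //; rewrite mulrAC mulrC; exact: NM.
pose F := [set I | exists b, [/\ R b, I = ann b & ann b `<=` p]].
have [||_ [b [Rb -> bp]] bmax] := @exists_maximal_member N F (ann 1) N0.
- exists 1; split=> //; first exact: integers1.
  by move=> x [Rx]; rewrite mul1r => -[r Rr <-]; rewrite mulrC; exact: pM.
- move=> _ [b [Rb -> _]]; split; first exact: iann.
  split; first exact: integers_nat.
  by rewrite mulrC; exists b.
have Fb c : R c -> ann (b * c) `<=` p -> ann (b * c) `<=` ann b.
  move=> Rc cp; apply: bmax; last exact: annM.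
  by exists (b * c); split=> //; exact: integersM.
exists b; split=> // [Nb|x px].
  by apply: p1; apply: bp; split; [exact: integers1|rewrite mulr1].
have Rx := pR _ px.
apply: contrapT => nNbx.
have annx : ann (b * x) `<=` p.
  move=> s [Rs Nbxs]; apply: contrapT => nps.
  have annbs : ann (b * s) `<=` p.
    move=> t [Rt Nbst]; apply: (maximal_prime mp Rs Rt) => //.
    by apply: bp; split; [exact: integersM|rewrite mulrA].
  by apply: nNbx; apply: (Fb s Rs annbs x _).2; split=> //; rewrite mulrAC.
have Fx := Fb x Rx annx.
(* Multiplication by powers of [x] does not change the annihilator either. *)
have FX k t : R t -> principal N%:R (b * x ^+ k * t) -> principal N%:R (b * t).
  elim: k t => [|k IH] t Rt; first by rewrite expr0 mulr1.
  rewrite exprSr mulrA -mulrA => /IH H.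
  have [|_ //] := Fx t; split=> //; rewrite -mulrA; apply: H; exact: integersM.
have [|i [j [ij [y Ry e]]]] := @pigeonhole_mod N (fun k => b * x ^+ k) N0.
  by move=> k; apply: integersM => //; exact: integersX.
have Nd : principal N%:R (b * (x ^+ (j - i) - 1)).
  apply: (FX i); first by apply: integersB; [exact: integersX|exact: integers1].
  exists y => //; rewrite -e mulrBr mulr1 -!mulrA -exprD subnKC 1?ltnW //.
have /bp pd : ann b (x ^+ (j - i) - 1).
  by split=> //; apply: integersB; [exact: integersX|exact: integers1].
apply: p1; have -> : 1 = x ^+ (j - i).-1 * x - (x ^+ (j - i) - 1) :> K.
  by rewrite -exprSr prednK ?subn_gt0 //; ring.
by apply: idealB => //; apply: pM => //; exact: integersX.
Qed.

(** Enlarge [A] to a maximal ideal [p] containing a positive integer [N] and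
    divide by [N] an element annihilated by [p] modulo [N]. *)
Lemma proper_ideal_multiplier A : nonzero_ideal A -> ~ A 1 ->
  exists2 v, ~ R v & forall x, A x -> R (v * x).
Proof.
move=> nA /(exists_maximal_ideal nA)[p mp Ap].
have [np _ _] := mp; have [N N0 pN] := nonzero_ideal_nat np.
have N0' : N%:R != 0 :> K by rewrite natK_neq0 -lt0n.
have [b [Rb nNb bp]] := maximal_annihilator mp N0 pN.
exists (b / N%:R) => [Rv|x /Ap/bp [r Rr e]].
  by apply: nNb; exists (b / N%:R) => //; rewrite mulrC divfK.
by rewrite mulrAC -e mulrC mulKf.
Qed.

(** * Invertibility *)

Definition inverse_ideal I : set K := [set y | forall x, I x -> R (x * y)].

Lemma inverse_ideal1 I : is_ideal I -> inverse_ideal I 1.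
Proof. by move=> [IR _ _ _] x /IR; rewrite mulr1. Qed.

(** If [I * inverse_ideal I] were proper, some [v] outside [R] would multiply it
    into [R], hence map [inverse_ideal I] to itself; as the powers of [v] then
    have a common denominator, [v] would be integral. *)
Lemma ideal_invertible I : nonzero_ideal I -> ideal_mul I (inverse_ideal I) 1.
Proof.
move=> nI; case: (nI) => iI _; case: (iI) => IR I0 ID IM.
have iA : is_ideal (ideal_mul I (inverse_ideal I)) by apply: ideal_mul_ideal =>
  // x y Ix; apply.
have [N N0 IN] := nonzero_ideal_nat nI.
have N0' : N%:R != 0 :> K by rewrite natK_neq0 -lt0n.
apply: contrapT => A1.
have nA : nonzero_ideal (ideal_mul I (inverse_ideal I)).
  apply: (nonzero_idealI iA _ N0').
  by rewrite -[N%:R]mulr1; apply: ideal_mul_in => //; exact: inverse_ideal1.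
have [v nRv vA] := proper_ideal_multiplier nA A1.
apply: nRv; apply: (almost_integral N0') => k.
suff : inverse_ideal I (v ^+ k) by apply.
elim: k => [|k IH]; first by rewrite expr0; exact: inverse_ideal1.
by move=> x Ix; rewrite exprS mulrCA; apply: vA; exact: ideal_mul_in.
Qed.

(** The cofactor is the ideal quotient [(J : I)]. *)
Lemma contains_dvd I J : nonzero_ideal I -> is_ideal J -> J `<=` I ->
  ideal_dvd I J.
Proof.
move=> nI iJ JI; case: (nI) => -[IR _ _ _] _; case: (iJ) => JR J0 JD JM.
have iC : is_ideal [set c | R c /\ forall x, I x -> J (x * c)].
  split=> [c []//||c d [Rc Jc] [Rd Jd]|r c Rr [Rc Jc]].
  - by split=> [|x]; [exact: integers0|rewrite mulr0].
  - by split=> [|x Ix]; [exact: integersD|rewrite mulrDr; apply: JD;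
    [exact: Jc|exact: Jd]].
  - by split=> [|x Ix]; [exact: integersM|rewrite mulrCA; apply: JM => //;
    exact: Jc].
exists [set c | R c /\ forall x, I x -> J (x * c)] => //; apply/seteqP;
  split=> [z Jz|z].
  rewrite -[z]mul1r; elim/ideal_mul_ind: 1 / (ideal_invertible nI) =>
    [|x y|x y Ix Iy].
  - by rewrite mul0r; exact: ideal_mul0.
  - by rewrite mulrDl; exact: ideal_mulD.
  - rewrite -mulrA; apply: ideal_mul_in => //; split.
      by rewrite mulrC; apply: Iy; exact: JI.
    by move=> t It; rewrite mulrA; apply: JM => //; exact: Iy.
by elim/ideal_mul_ind: z / => // x y Ix [_]; apply.
Qed.

(** For [v] outside [R] with [v p] contained in [R], all the [v ^ n a] would be
    integral. *)
Lemma maximal_ideal_exp_inter p a : maximal_ideal p ->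
  (forall n, ideal_exp p n a) -> a = 0.
Proof.
move=> [np p1 _] pa; apply: contrapT => /eqP a0.
have [v nRv vp] := proper_ideal_multiplier np p1.
apply: nRv; apply: (almost_integral a0) => k; move: (pa k).
elim: k a {a0 pa} => [|k IH] a; first by rewrite mulr1.
rewrite /ideal_exp iterS; elim/ideal_mul_ind: a / => [|x y|x y px].
- by rewrite mul0r => *; exact: integers0.
- by rewrite mulrDl => ? ?; exact: integersD.
- move=> /IH Ry; have -> : x * y * v ^+ k.+1 =
  (v * x) * (y * v ^+ k) by rewrite exprS; ring.
  by apply: integersM => //; exact: vp.
Qed.

(** If [I = I p], multiplying by the inverse of [I] gives [R = p]. *)
Lemma mul_maximal_proper I p : nonzero_ideal I -> maximal_ideal p ->
  exists2 u, I u & ~ ideal_mul I p u.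
Proof.
move=> nI [[[pR p0 pD pM] _] p1 _]; apply: contrapT => nu; apply: p1.
elim/ideal_mul_ind: 1 / (ideal_invertible nI) => // x y Ix Iy.
have : ideal_mul I p x by apply: contrapT => nx; apply: nu; exists x.
elim/ideal_mul_ind: x / {Ix} => [|x z|x z Ix pz]; first by rewrite mul0r.
  by rewrite mulrDl; exact: pD.
by rewrite mulrAC; apply: pM => //; exact: Iy.
Qed.

(** The product of [A] and the inverse of [I] is a proper ideal, hence contained
    in some maximal [p]; multiply by [I]. *)
Lemma proper_sub_mul_maximal I A : nonzero_ideal I -> nonzero_ideal A ->
  A `<=` I -> A <> I -> exists2 p, maximal_ideal p & A `<=` ideal_mul I p.
Proof.
move=> nI nA AI neAI; case: (nA) => iA _; case: (iA) => AR A0 AD AM.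
pose B := ideal_mul A (inverse_ideal I).
have iB : is_ideal B by apply: ideal_mul_ideal => // x y /AI Ix; apply.
have [N N0 AN] := nonzero_ideal_nat nA.
have nB : nonzero_ideal B.
  apply: (@nonzero_idealI _ N%:R) => //; last by rewrite natK_neq0 -lt0n.
  rewrite -[N%:R]mulr1; apply: ideal_mul_in => //; apply: inverse_ideal1.
  by case: nI.
have nB1 : ~ B 1.
  move=> B1; apply: neAI; apply/seteqP; split=> // x Ix; rewrite -[x]mulr1.
  elim/ideal_mul_ind: 1 / B1 => [|y z|y z Ay Iz]; first by rewrite mulr0.
    by rewrite mulrDr; exact: AD.
  have -> : x * (y * z) = x * z * y by ring.
  by apply: AM => //; exact: Iz.
have [p mp Bp] := exists_maximal_ideal nB nB1.
exists p => // a Aa; rewrite -[a]mul1r.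
elim/ideal_mul_ind: 1 / (ideal_invertible nI) => [|x y|x y Ix Iy].
- by rewrite mul0r; exact: ideal_mul0.
- by rewrite mulrDl; exact: ideal_mulD.
by rewrite -mulrA; apply: ideal_mul_in => //; rewrite mulrC; apply: Bp;
  exact: ideal_mul_in.
Qed.

End Dedekind.

(** * Moduli *)

Section ModulusTheory.
Variables (RR : realType) (K : fieldExtType rat) (m : modulus RR K).
Implicit Types (x y a b : K) (I J A : set K).
Local Notation R := (integers K).
Local Notation m0 := (mod_zero m).

Lemma addcosetE x I y : addcoset x I y <-> I (y - x).
Proof.
split=> [[z Iz <-]|Iyx]; first by rewrite addrC addKr.
by exists (y - x); rewrite // addrC subrK.
Qed.

Lemma addcoset_eq x y I : is_ideal I -> addcoset x I y ->
  addcoset x I = addcoset y I.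
Proof.
move=> iI /addcosetE Iyx; have ID : forall u v, I u -> I v ->
  I (u + v) by case: iI.
apply/seteqP; split=> z /addcosetE Iz; apply/addcosetE.
  have -> : z - y = (z - x) - (y - x) by ring.
  exact: idealB.
have -> : z - x = (z - y) + (y - x) by ring.
exact: ID.
Qed.

Lemma nonzero_ideal_exp (p : set K) n : nonzero_ideal p ->
  nonzero_ideal (ideal_exp p n).
Proof.
move=> np; elim: n => [|n IH]; last exact: nonzero_mul_ideal.
by apply: nonzero_idealI; [exact: integers_ideal|exact: integers1|exact:
  oner_neq0].
Qed.

Lemma nonzero_prime_maximal (p : nonzero_primes K) : maximal_ideal (val p).
Proof. by have [] := set_mem (valP p); exact: prime_maximal. Qed.

(** A factor other than [R] is contained in its prime, so this prime contains
    the whole product; the primes with trivial factor do not occur in it. *)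
Lemma mod_zero_ind (P : set K -> Prop) : P R ->
  (forall (p : nonzero_primes K) n A, m0 `<=` val p -> is_ideal A ->
     P A -> P (ideal_mul (ideal_exp (val p) n) A)) -> P m0.
Proof.
move=> PR PM; pose F p := ideal_exp (val p) (m (inr p)).
have iF p : is_ideal (F p).
  by have [np _ _] := nonzero_prime_maximal p;
    case: (nonzero_ideal_exp (m (inr p)) np).
have iprod (s : seq (nonzero_primes K)) :
  is_ideal (\big[@ideal_mul K/R]_(p <- s) F p).
  by elim/big_rec: _ => [|p A _]; [exact: integers_ideal|exact: mul_ideal].
have prod_sub (s : seq (nonzero_primes K)) p : p \in s ->
    \big[@ideal_mul K/R]_(q <- s) F q `<=` F p.
  elim: s => // q s IH; rewrite inE big_cons => /orP[/eqP <-|/IH sub];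
    first exact: ideal_mul_subl.
  by apply: subset_trans sub; exact: ideal_mul_subr.
pose s := finite_support R [set: nonzero_primes K] F.
have m0E : m0 = \big[@ideal_mul K/R]_(p <- s) F p by [].
have sub p : p \in s -> m0 `<=` val p.
  move=> ps; rewrite m0E; apply: (subset_trans (prod_sub _ _ ps)).
  have FR : F p <> R.
    move: ps; rewrite /s; case: finite_supportP => // X _ _ XE pX.
    have : ([set: nonzero_primes K] `&` F @^-1` [set~ R]) p by rewrite -XE.
    by case.
  move: FR; rewrite /F; case: (m (inr p)) => [//|n] _.
  have [np _ _] := nonzero_prime_maximal p.
  by apply: ideal_mul_subl; [case: np|case: (nonzero_ideal_exp n np)].
rewrite m0E; elim: {m0E}s sub => [|p t IH] sub; first by rewrite big_nil.
rewrite big_cons; apply: PM => //; first by apply: sub; rewrite mem_head.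
by apply: IH => q qt; apply: sub; rewrite inE qt orbT.
Qed.

Lemma mod_zero_nonzero : nonzero_ideal m0.
Proof.
apply: mod_zero_ind => [|p n A _ _ nA].
  by apply: nonzero_idealI; [exact: integers_ideal|exact: integers1|exact:
    oner_neq0].
apply: nonzero_mul_ideal nA; apply: nonzero_ideal_exp.
by case: (nonzero_prime_maximal p).
Qed.

Lemma mod_zero_ideal : is_ideal m0. Proof. by case: mod_zero_nonzero. Qed.

(** With [a b = 1] modulo [I] and [a c = 1] modulo [J], the product
    [(1 - a b) (1 - a c)] has the form [1 - a e]. *)
Lemma unit_mod_mul I J a : is_ideal I -> R a ->
  (exists2 b, R b & I (a * b - 1)) -> (exists2 b, R b & J (a * b - 1)) ->
  exists2 b, R b & ideal_mul I J (a * b - 1).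
Proof.
move=> iI Ra [b Rb Ib] [c Rc Jc].
exists (b + c - a * b * c).
  by apply: integersB; [exact: integersD|do 2?apply: integersM].
have -> : a * (b + c - a * b * c) - 1 = (- (a * b - 1)) * (a * c - 1) by ring.
by apply: ideal_mul_in => //; exact: idealN.
Qed.

(** A prime containing [m0] divides it. If the valuation of a nonzero [a] at it
    vanishes, then [a] is outside the prime, since it cannot belong to all of
    its powers. Hence [a] is a unit modulo every factor of [m0], and so modulo
    [m0]. *)
Lemma R_modE a : R_mod m a <->
  [/\ R a, a != 0 & exists2 b, R b & m0 (a * b - 1)].
Proof.
split=> [[Ra a0 va]|[Ra a0 [b Rb m0b]]]; split=> //.
  have unitR : exists2 b, R b & R (a * b - 1).
    exists 1; first exact: integers1.
    by rewrite mulr1; apply: integersB => //; exact: integers1.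
  apply: (@mod_zero_ind (fun A => exists2 b, R b & A (a * b - 1))) => //.
  move=> p n A m0p iA; have mp := nonzero_prime_maximal p;
    have [np p1 pmax] := mp.
  have npa : ~ val p a.
    move=> pa; have /va : ideal_dvd (val p) m0 by apply: contains_dvd => //;
      exact: mod_zero_ideal.
    rewrite /valuation; case: xgetP => [k -> [pk pSk] k0|nk _].
      by apply: pSk; rewrite k0 /ideal_exp /= -[a]mulr1;
        apply: ideal_mul_in => //; exact: integers1.
    move/eqP: a0; apply; apply: (maximal_ideal_exp_inter mp) => k.
    elim: k => [//|k IH]; apply: contrapT => pSk; exact: (nk k).
  apply: unit_mod_mul => //; first by case: (nonzero_ideal_exp n np).
  elim: n => [|n IH]; first exact: unitR.
  rewrite /ideal_exp iterS; apply: unit_mod_mul => //; first by case: np.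
  exact: pmax.
move=> p [C iC m0C]; have [np p1 _] := nonzero_prime_maximal p;
  case: (np) => ip _.
have npa : ~ val p a.
  move=> pa; apply: p1; have -> : 1 = b * a - (a * b - 1) :> K by ring.
  apply: idealB => //; first by case: ip => _ _ _; apply.
  by move: m0b; rewrite m0C; exact: ideal_mul_subl.
rewrite /valuation; case: xgetP => [[//|k] _ [pk _]|//].
case: npa; apply: (@ideal_mul_subl _ (val p) (ideal_exp (val p) k)) => //.
by case: (nonzero_ideal_exp k np).
Qed.

Lemma coprime_idealsP I : is_ideal I ->
  (coprime_ideals I m0 <-> exists2 a, I a & m0 (a - 1)).
Proof.
move=> iI; split=> [IR|[a Ia m0a]].
  have [x Ix [y m0y xy]] : ideal_add I m0 1 by rewrite IR; exact: integers1.
  exists x => //; have -> : x - 1 = - y by rewrite -xy; ring.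
  exact: idealN mod_zero_ideal _.
case: iI mod_zero_ideal => IR _ _ IM [mR _ _ mM].
apply/seteqP; split=> [_ [x /IR Rx [y /mR Ry <-]]|x Rx]; first exact: integersD.
exists (x * a); first exact: IM.
exists (- (x * (a - 1))); last by ring.
by apply: idealN; [exact: mod_zero_ideal|exact: mM].
Qed.

(** * The monoid of integers with class in a subgroup *)

Variable Gamma : set (residue m).
Hypothesis gGamma : residue_subgroup Gamma.
Local Notation S := (R_modGamma Gamma).

Lemma R_modGamma_integer a : S a -> R a. Proof. by case=> -[]. Qed.
Lemma R_modGamma_neq0 a : S a -> a != 0. Proof. by case=> -[]. Qed.

Lemma coset_mulE a b : R a -> R b ->
  coset_mul m (addcoset a m0) (addcoset b m0) = addcoset (a * b) m0.
Proof.
case: mod_zero_ideal => mR m00 mD mM Ra Rb; apply/seteqP; split=> z.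
  move=> [_ [_ [x mx <-] [_ [y my <-] <-]] [t mt <-]]; apply/addcosetE.
  have -> : (a + x) * (b + y) + t - a * b =
    (a * y + b * x) + (x * y + t) by ring.
  have m0M r u : R r -> m0 u -> m0 (r * u) by exact: mM.
  by apply: (mD) (mD _ _ (m0M _ _ Ra my) (m0M _ _ Rb mx)) (mD _ _ (m0M _ _ (mR
    _ mx) my) mt).
move=> [t mt <-]; exists (a * b); last by exists t.
by exists a; [|exists b => //]; exists 0; rewrite ?addr0.
Qed.

Lemma residue_classM a b : R a -> R b ->
  residue_class m (a * b) = residue_mul (residue_class m a) (residue_class m b).
Proof.
move=> Ra Rb; rewrite /residue_mul /residue_class /= coset_mulE //.
by congr (_, _); apply/funext => w; rewrite rmorphM sgzM.
Qed.

Lemma R_modGammaM a b : S a -> S b -> S (a * b).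
Proof.
move=> [/R_modE [Ra a0 ua] Ga] [/R_modE [Rb b0 ub] Gb]; split.
  apply/R_modE; split; [exact: integersM|exact: mulf_neq0|].
  case: ua ub => c Rc mc [d Rd md]; exists (c * d); first exact: integersM.
  case: mod_zero_ideal => mR _ mD mM.
  have -> : a * b * (c * d) - 1 = (a * c) * (b * d - 1) + (a * c - 1) by ring.
  by apply: mD => //; apply: mM => //; exact: integersM.
by rewrite residue_classM //; case: gGamma => _ _ GM _; exact: GM.
Qed.

(** The class of [a] has an inverse in [Gamma]. *)
Lemma R_modGamma_div a b : S a -> R b -> S (a * b) -> S b.
Proof.
move=> [/R_modE [Ra a0 ua] Ga] Rb [/R_modE [Rab ab0 [c Rc mc]] Gab]; split.
  apply/R_modE; split=> //; first by apply: contraNneq ab0 => ->; rewrite mulr0.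
  by exists (a * c); [exact: integersM|rewrite mulrCA mulrA].
case: gGamma => /[dup] GU _ _ GM /(_ _ Ga)[h Gh ah].
have [hs [a' [_ [Ra' _ _ hE]]]] := GU _ Gh.
have : Gamma (residue_mul h (residue_class m (a * b))) by exact: GM.
congr (Gamma _); rewrite residue_classM //.
rewrite /residue_mul /residue_class /=; congr (_, _).
  apply/funext => w; have := congr1 (@^~ w) (congr1 fst ah) => /= e.
  by rewrite mulrA [h.1 w * _]mulrC e mul1r.
rewrite hE (coset_mulE Ra Rb) (coset_mulE Ra' Rab).
apply/esym/addcoset_eq; first exact: mod_zero_ideal.
apply/addcosetE.
have /addcosetE : addcoset 1 m0 (a * a').
  have := congr1 snd ah; rewrite /= hE coset_mulE // => <-.
  by apply/addcosetE; rewrite subrr; case: mod_zero_ideal.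
have -> : a' * (a * b) - b = b * (a * a' - 1) by ring.
by case: mod_zero_ideal => _ _ _; apply.
Qed.

Lemma R_modGamma_pos a : R a -> a != 0 -> m0 (a - 1) ->
  (forall w : real_embedding RR K, 0 < w a) -> S a.
Proof.
move=> Ra a0 ma wa; split.
  by apply/R_modE; split=> //; exists 1; [exact: integers1|rewrite mulr1].
suff -> : residue_class m a = residue_one m by case: gGamma.
congr (_, _); first by apply/funext => w; apply: gtr0_sgz; exact: wa.
apply/esym/addcoset_eq; first exact: mod_zero_ideal.
exact/addcosetE.
Qed.

Lemma R_modGamma1 : S 1.
Proof.
apply: R_modGamma_pos => [|||w]; [exact: integers1|exact: oner_neq0| |].
  by rewrite subrr; case: mod_zero_ideal.
by rewrite rmorph1 ltr01.
Qed.

(** The quadratic polynomial [t + N (t^2 + 1)] is positive on the reals for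
    [N > 0], so adding [N (a^2 + 1)] makes [a] positive at all real
    embeddings; a second choice of [N] is needed only to avoid zero. *)
Lemma R_modGamma_shift a N : R a -> m0 (a - 1) -> (0 < N)%N -> m0 N%:R ->
  exists2 c, R c & S (a + N%:R * c).
Proof.
move=> Ra ma N0 mN; case: mod_zero_ideal => mR m00 mD mM.
have Rc : R (a ^+ 2 + 1) by apply: integersD;
  [exact: integersX|exact: integers1].
have pos n : (0 < n)%N -> a + N%:R * (n%:R * (a ^+ 2 + 1)) != 0 ->
    S (a + N%:R * (n%:R * (a ^+ 2 + 1))).
  move=> n0 ne0; have Rn : R (n%:R * (a ^+ 2 + 1)) by apply: integersM => //;
    exact: integers_nat.
  apply: R_modGamma_pos => // [||w].
  - by apply: integersD => //; apply: integersM => //; exact: mR.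
  - by rewrite addrAC; apply: mD => //; rewrite mulrC; exact: mM.
  - rewrite rmorphD !rmorphM /= !rmorph_nat rmorphD rmorphXn rmorph1 /= mulrA
    -natrM.
    have : 1 <= (N * n)%:R :> RR by rewrite ler1n muln_gt0 N0.
    move: ((N * n)%:R : RR) (w a) => M t M1.
    have h1 : 0 <= (M - 1) * (t ^+ 2 + 1).
      by apply: mulr_ge0; [lra|rewrite addr_ge0 ?sqr_ge0].
    have h2 := sqr_ge0 (t + 1).
    have h3 := sqr_ge0 t.
    have -> : t + M * (t ^+ 2 + 1) =
      (M - 1) * (t ^+ 2 + 1) + ((t + 1) ^+ 2 + t ^+ 2 + 1) / 2%:R by field.
    by lra.
have [e1 | ?] := eqVneq (a + N%:R * (1%:R * (a ^+ 2 + 1))) 0; last first.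
  exists (1%:R * (a ^+ 2 + 1)); last exact: pos.
  by rewrite mul1r.
have [e2 | ?] := eqVneq (a + N%:R * (2%:R * (a ^+ 2 + 1))) 0; last first.
  exists (2%:R * (a ^+ 2 + 1)); last exact: pos.
  by apply: integersM => //; exact: integers_nat.
have N0' : N%:R != 0 :> K by rewrite natK_neq0 -lt0n.
have e3 : a ^+ 2 + 1 = 0.
  apply: (mulfI N0'); rewrite mulr0 -[RHS](subr0 0) -{1}e2 -e1; ring.
have a0 : a = 0 by move: e1; rewrite e3 !mulr0 addr0.
by move: e3; rewrite a0 expr0n add0r => /eqP; rewrite oner_eq0.
Qed.

Local Notation coprime_ideal := (coprime_integral_ideals m).

(** An element of [I] that is [1] modulo [m0] can be moved into the monoid
    within its class modulo an integer of [I & m0]. *)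
Lemma coprime_idealE I : coprime_ideal I <->
  is_ideal I /\ exists a, [/\ I a, S a & m0 (a - 1)].
Proof.
split=> [[nI cI]|[iI [a [Ia Sa ma]]]]; last first.
  split; last by apply/coprime_idealsP => //; exists a.
  by apply: nonzero_idealI Ia _ => //; exact: R_modGamma_neq0.
case: (nI) => iI _; split=> //; case: (iI) => IR _ ID IM.
have [a Ia ma] := (coprime_idealsP iI).1 cI.
have [N N0 [IN mN]] : exists2 N, (0 < N)%N & (I `&` m0) N%:R.
  apply: nonzero_ideal_nat.
  have [[N N0 IN] [M M0 mM]] := (nonzero_ideal_nat nI, nonzero_ideal_nat
    mod_zero_nonzero).
  apply: (@nonzero_idealI _ _ (N * M)%:R).
  - by apply: setI_ideal => //; exact: mod_zero_ideal.
  - split; rewrite natrM; last by case: mod_zero_ideal => _ _ _; apply => //;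
    exact: integers_nat.
    by rewrite mulrC; apply: IM => //; exact: integers_nat.
  - by rewrite natK_neq0 -lt0n muln_gt0 N0.
have [c Rc Sc] := R_modGamma_shift (IR _ Ia) ma N0 mN.
exists (a + N%:R * c); split=> //.
  by apply: ID => //; rewrite mulrC; exact: IM.
case: mod_zero_ideal => _ _ mD mM.
by rewrite addrAC; apply: mD => //; rewrite mulrC; exact: mM.
Qed.

End ModulusTheory.

(** * Prime avoidance *)

Section Avoidance.
Variables (RR : realType) (K : fieldExtType rat) (m : modulus RR K).
Variable Gamma : set (residue m).
Hypothesis gGamma : residue_subgroup Gamma.
Implicit Types (x y a b u s : K) (I J A p : set K).
Local Notation R := (integers K).
Local Notation m0 := (mod_zero m).
Local Notation S := (R_modGamma Gamma).

(** [I / (I p)] is a vector space over the field [R / p]. *)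
Lemma mul_maximal_primary I p u s : is_ideal I -> maximal_ideal p ->
  I u -> R s -> ~ p s -> ideal_mul I p (u * s) -> ideal_mul I p u.
Proof.
move=> iI [[ip _] _ pmax] Iu Rs ps Ipus; have [r Rr pr] := pmax _ Rs ps.
have -> : u = r * (u * s) - u * (s * r - 1) by ring.
have iIp := mul_ideal iI ip; apply: idealB => //; last exact: ideal_mul_in.
by case: iIp => _ _ _; apply.
Qed.

Lemma family_nonzero_nat n (A : nat ->
  set K) : (forall i, nonzero_ideal (A i)) ->
  exists2 N, (0 < N)%N & forall i, (i < n)%N -> A i N%:R.
Proof.
move=> nA; elim: n => [|n [N N0 AN]]; first by exists 1%N.
have [M M0 AM] := nonzero_ideal_nat (nA n).
exists (N * M)%N; first by rewrite muln_gt0 N0.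
move=> i; rewrite ltnS leq_eqVlt => /orP[/eqP -> | /AN ANi]; rewrite natrM.
  by have [[_ _ _ AMul] _] := nA n; apply: AMul => //; exact: integers_nat.
by rewrite mulrC; have [[_ _ _ AMul] _] := nA i; apply: AMul => //;
  exact: integers_nat.
Qed.

(** A correction by [u * s * t], with [u] in [I] outside [I p_n], [s] in [m0]
    and [t] in the earlier [p_i] but neither in [p_n], moves [a] out of [I p_n]
    without disturbing what was achieved before. If [m0] is contained in [p_n],
    then [a], being [1] modulo [m0], is outside [I p_n] already. *)
Lemma avoid_maximal_mod n I (p : nat -> set K) : coprime_integral_ideals m I ->
  (forall i, maximal_ideal (p i)) ->
  exists a, [/\ I a, m0 (a - 1) & forall i, (i < n)%N -> ~ ideal_mul I (p i) a].
Proof.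
move=> cI mp; have [nI _] := cI; have [iI [a0 [Ia0 _ ma0]]] :=
  (coprime_idealE gGamma I).1 cI.
have ip i : is_ideal (p i) by have [[]] := mp i.
have iIp i : is_ideal (ideal_mul I (p i)) by exact: mul_ideal.
have [IR I0 ID IM] := iI; have [mR m00 mD mM] := mod_zero_ideal m.
elim: n => [|n [a [Ia ma an]]]; first by exists a0.
have [pa | pa] := pselect (ideal_mul I (p n) a); last first.
  by exists a; split=> // i; rewrite ltnS leq_eqVlt => /orP[/eqP ->|/an].
have [_ pn1 pnmax] := mp n.
have [s ms ps] : exists2 s, m0 s & ~ p n s.
  apply: contrapT => ns; apply: pn1; have -> : 1 = a - (a - 1) :> K by ring.
  apply: idealB => //; first exact: ideal_mul_subr pa.
  by apply: contrapT => np; apply: ns; exists (a - 1).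
have [t [Rt pt tn]] : exists t, [/\ R t, ~ p n t & forall i, (i < n)%N ->
  p i t].
  suff H k : (k <= n)%N -> exists t, [/\ R t, ~ p n t & forall i, (i < k)%N ->
    p i t] by exact: H.
  elim: k => [|k IH] kn; first by exists 1; split=> //; exact: integers1.
  have [t [Rt pt tk]] := IH (ltnW kn).
  have [r pr npr] : exists2 r, p k r & ~ p n r.
    apply: contrapT => nr; apply: (an k kn).
    suff -> : p k = p n by [].
    have sub : p k `<=` p n by move=> r pr; apply: contrapT => npr; apply: nr;
      exists r.
    apply/seteqP; split=> // r pnr; apply: contrapT => pkr.
    have [_ _ pkmax] := mp k; have Rr : R r by case: (ip n) => pR _ _ _;
      exact: pR.
    have [b Rb pb] := pkmax _ Rr pkr.
    apply: pn1; have -> : 1 = b * r - (r * b - 1) :> K by ring.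
    by apply: idealB => //; [case: (ip n) => _ _ _; apply|exact: sub].
  have Rr : R r by case: (ip k) => pR _ _ _; exact: pR.
  exists (t * r); split=> [|ptr|i]; first exact: integersM.
    exact/npr/(maximal_prime (mp n) Rt Rr ptr pt).
  rewrite ltnS leq_eqVlt => /orP[/eqP ->|/tk pit];
    first by case: (ip k) => _ _ _; apply.
  by rewrite mulrC; case: (ip i) => _ _ _; apply.
have [u Iu nu] := mul_maximal_proper nI (mp n).
have Rs := mR _ ms; have Ru := IR _ Iu.
exists (a + u * s * t); split.
- by apply: ID => //; rewrite -mulrA mulrC; apply: IM => //; exact: integersM.
- by rewrite addrAC; apply: mD => //; rewrite mulrAC; apply: mM => //;
  exact: integersM.
move=> i; rewrite ltnS leq_eqVlt => /orP[/eqP ->|iltn] Ipi.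
  apply/nu/(mul_maximal_primary iI (mp n) Iu Rs ps).
  apply: (mul_maximal_primary iI (mp n) _ Rt pt); first by rewrite mulrC;
    exact: IM.
  by have -> : u * s * t = (a + u * s * t) - a; [ring|exact: idealB].
apply: (an i iltn); have -> : a = (a + u * s * t) - u * s * t by ring.
apply: idealB => //; apply: ideal_mul_in; last exact: tn.
by rewrite mulrC; exact: IM.
Qed.

(** The correction that makes [a] positive is a multiple of an integer lying in
    all the ideals [I p_i], so [a] stays outside of them. *)
Lemma avoid_maximal n I (p : nat -> set K) : coprime_integral_ideals m I ->
  (forall i, maximal_ideal (p i)) ->
  exists a, [/\ I a, S a & forall i, (i < n)%N -> ~ ideal_mul I (p i) a].
Proof.
move=> cI mp; have [nI _] := cI; have [iI _] := nI; case: (iI) => IR _ ID IM.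
have [a [Ia ma an]] := avoid_maximal_mod n cI mp.
have np i : nonzero_ideal (p i) by case: (mp i).
have nIp i : nonzero_ideal (ideal_mul I (p i)) by exact: nonzero_mul_ideal.
have [N N0 IpN] := family_nonzero_nat n nIp.
have [M M0 mIM] := nonzero_ideal_nat (nonzero_mul_ideal nI (mod_zero_nonzero
  m)).
have im := mod_zero_ideal m; case: (im) => _ _ mD mM.
have NM0 : (0 < N * M)%N by rewrite muln_gt0 N0.
have IM' : I M%:R by exact: ideal_mul_subl mIM.
have mM' : m0 M%:R by exact: ideal_mul_subr mIM.
have mNM : m0 (N * M)%:R by rewrite natrM; apply: mM => //; exact: integers_nat.
have [c Rc Sc] := R_modGamma_shift gGamma (IR _ Ia) ma NM0 mNM.
exists (a + (N * M)%:R * c); split=> // [|i /[dup] iltn /an nIa Ipi].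
  apply: ID => //; rewrite natrM mulrC mulrA; apply: IM => //.
  by apply: integersM => //; exact: integers_nat.
apply: nIa; have -> : a = (a + (N * M)%:R * c) - c * M%:R * N%:R
  by rewrite natrM; ring.
case: (nIp i) => iIp _; apply: idealB => //; case: iIp => _ _ _; apply;
  last exact: IpN.
by apply: integersM => //; exact: integers_nat.
Qed.

End Avoidance.

(** * Constructible ideals *)

Section GroupSubsets.
Variable G : groupType.
Implicit Types (P X : set G) (p g : G).

Lemma translateE p X g : translate p X g <-> X (p^-1 * g)%g.
Proof.
split=> [[h Xh <-]|Xg]; first by rewrite mulKg.
by exists (p^-1 * g)%g => //; rewrite mulVKg.
Qed.

Lemma pretranslateE P p X g : pretranslate P p X g <-> X (p * g)%g /\ P g.
Proof.
split=> [[[h Xh <-] Pg]|[Xg Pg]]; first by rewrite mulVKg.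
by split=> //; exists (p * g)%g => //; rewrite mulKg.
Qed.

End GroupSubsets.

Section AffineConstructible.
Variables (RR : realType) (K : fieldExtType rat) (m : modulus RR K).
Variable Gamma : set (residue m).
Hypothesis gGamma : residue_subgroup Gamma.
Implicit Types (x y a b : K) (I J : set K) (g h : affine K).
Local Notation R := (integers K).
Local Notation m0 := (mod_zero m).
Local Notation S := (R_modGamma Gamma).
Local Notation P := (R_rtimes_R_modGamma Gamma).
Local Notation coprime_ideal := (coprime_integral_ideals m).

Lemma affine_mulE1 g h : (g * h)%g.1 = g.1 + val g.2 * h.1. Proof. by []. Qed.
Lemma affine_mulE2 g h : val (g * h)%g.2 = val g.2 * val h.2. Proof. by []. Qed.

Definition affine_of a (a0 : a != 0) b : affine K := (b, exist _ a a0).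

Lemma coset_rtimesE x I g :
  coset_rtimes Gamma x I g <-> [/\ I (g.1 - x), I (val g.2) & S (val g.2)].
Proof.
rewrite /coset_rtimes /=; split=> [[/addcosetE Ig [Ia Sa]]|[/addcosetE Ig Ia
  Sa]] //.
Qed.

Lemma coset_rtimes_full : coset_rtimes Gamma 0 R = P.
Proof.
apply/seteqP; split=> g; rewrite coset_rtimesE subr0; first by case.
by move=> [Rg Sa]; split=> //; exact: R_modGamma_integer Sa.
Qed.

Lemma coprime_full : coprime_ideal R.
Proof.
apply/(coprime_idealE gGamma); split; first exact: integers_ideal.
exists 1; split; [exact: integers1|exact: R_modGamma1|].
by rewrite subrr; case: (mod_zero_ideal m).
Qed.

Lemma coprime_setI I J : coprime_ideal I -> coprime_ideal J ->
  coprime_ideal (I `&` J).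
Proof.
move=> /(coprime_idealE gGamma)[iI [a [Ia Sa ma]]] /(coprime_idealE gGamma)[iJ
  [b [Jb Sb mb]]].
apply/(coprime_idealE gGamma); split; first exact: setI_ideal.
have [Ra Rb] := (R_modGamma_integer Sa, R_modGamma_integer Sb).
exists (a * b); split; last 2 first.
- exact: R_modGammaM.
- case: (mod_zero_ideal m) => mR m00 mD mM.
  have -> : a * b - 1 = b * (a - 1) + (b - 1) by ring.
  by apply: mD => //; exact: mM.
by split; [rewrite mulrC; case: iI => _ _ _; apply|case: iJ => _ _ _; apply].
Qed.

Lemma coprime_scale a I : S a -> coprime_ideal I ->
  coprime_ideal (scale_ideal a I).
Proof.
move=> Sa [nI cI]; have [iI _] := nI; have Ra := R_modGamma_integer Sa.
have iaI : is_ideal (scale_ideal a I) by exact: scale_ideal_ideal.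
split.
  have [N N0 IN] := nonzero_ideal_nat nI.
  apply: (@nonzero_idealI _ _ (a * N%:R)) => //; first by exists N%:R.
  by rewrite mulf_neq0 ?(R_modGamma_neq0 Sa) // natK_neq0 -lt0n.
apply/(coprime_idealsP m iaI); have [i Ii mi] := (coprime_idealsP m iI).1 cI.
have [/R_modE[_ _ [b Rb mb]] _] := Sa.
have Ri : R i by case: iI => IR _ _ _; exact: IR.
exists (a * (b * i)); first by exists (b * i) => //; case: iI => _ _ _; apply.
have -> : a * (b * i) - 1 = i * (a * b - 1) + (i - 1) by ring.
by case: (mod_zero_ideal m) => _ _ mD mM; apply: mD => //; exact: mM.
Qed.

Definition colon a I : set K := [set y | R y /\ I (a * y)].

Lemma coprime_colon a I : R a -> coprime_ideal I -> coprime_ideal (colon a I).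
Proof.
move=> Ra /(coprime_idealE gGamma)[iI [b [Ib Sb mb]]];
  case: (iI) => IR I0 ID IM.
apply/(coprime_idealE gGamma); split.
  split=> [y []//||y z [Ry Iy] [Rz Iz]|r y Rr [Ry Iy]].
  - by split; [exact: integers0|rewrite mulr0].
  - by split; [exact: integersD|rewrite mulrDr; exact: ID].
  - by split; [exact: integersM|rewrite mulrCA; exact: IM].
by exists b; split=> //; split; [exact: IR|exact: IM].
Qed.

Lemma setI_coset_rtimes x y z I J : is_ideal I -> is_ideal J ->
  addcoset x I z -> addcoset y J z ->
  coset_rtimes Gamma x I `&` coset_rtimes Gamma y J =
    coset_rtimes Gamma z (I `&` J).
Proof.
move=> iI iJ xz yz; rewrite /coset_rtimes (addcoset_eq iI xz) (addcoset_eq iJ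
  yz).
apply/seteqP; split=> g.
  by move=> [[/addcosetE ? []] ? ? [/addcosetE ? []] ? ?]; split=> //;
    exact/addcosetE.
by move=> [/addcosetE[? ?] [[? ?] ?]]; split; split=> //; exact/addcosetE.
Qed.

(** For [a] and [a s] in the monoid, so is [s]; hence [a (I & S)] is all of
    [a I & S]. *)
Lemma translate_coset_rtimes g x I : P g -> is_ideal I ->
  translate g (coset_rtimes Gamma x I) =
  coset_rtimes Gamma (g.1 + val g.2 * x) (scale_ideal (val g.2) I).
Proof.
move=> [Rb Sa] iI; have a0 := R_modGamma_neq0 Sa; have [IR _ _ _] := iI.
apply/seteqP; split=> h; rewrite translateE !coset_rtimesE.
  rewrite -{4 5 6}(mulVKg g h).
  move: (g^-1 * h)%g => k [Ik Ia Sk]; rewrite affine_mulE1 affine_mulE2; split.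
  - by exists (k.1 - x); rewrite // mulrBr; ring.
  - by exists (val k.2).
  - exact: R_modGammaM.
rewrite -{1 2 3}(mulVKg g h).
move: (g^-1 * h)%g => k; rewrite affine_mulE1 affine_mulE2 =>
  -[[r Ir e1] [s Is e2] Sk].
have {}e1 : k.1 - x = r.
  by apply: (mulfI a0); rewrite e1; ring.
have {}e2 := mulfI a0 e2; rewrite e1 -e2; split=> //.
by apply: (R_modGamma_div gGamma Sa (IR _ Is)); rewrite e2.
Qed.

Lemma pretranslate_coset_rtimes g x y I : P g -> is_ideal I -> R y ->
  addcoset x I (g.1 + val g.2 * y) ->
  pretranslate P g (coset_rtimes Gamma x I) =
  coset_rtimes Gamma y (colon (val g.2) I).
Proof.
move=> [Rb Sa] iI Ry xy; have Ra := R_modGamma_integer Sa.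
rewrite /coset_rtimes (addcoset_eq iI xy).
apply/seteqP; split=> h; rewrite pretranslateE.
  move=> [[/addcosetE]]; rewrite affine_mulE1 affine_mulE2 =>
    I1 [I2 S2] [Rh Sh].
  split; last by split=> //; split=> //; exact: R_modGamma_integer Sh.
  apply/addcosetE; split; first exact: integersB.
  by congr (I _): I1; ring.
move=> [/addcosetE [Rhy Ihy] [[Rh Ih] Sh]]; split; last first.
  by split=> //; rewrite -[h.1](subrK y); exact: integersD.
split; last by split=> //; exact: R_modGammaM.
apply/addcosetE; rewrite affine_mulE1; congr (I _): Ihy; ring.
Qed.

(** Each operation generating the constructible sets acts on the data [x], [I]:
    translations scale the ideal, pretranslations take an ideal quotient, and
    intersections intersect. *)
Lemma constructible_coset X : constructible P X ->
  X = set0 \/ exists x I, [/\ R x, coprime_ideal I & X =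
    coset_rtimes Gamma x I].
Proof.
elim=> {X} [||g X Pg _|g X Pg _|X Y _ IX _ IY].
- by left.
- by right; exists 0, R; split; [exact: integers0|exact: coprime_full|rewrite
  coset_rtimes_full].
- move=> [->|[x [I [Rx cI ->]]]].
    by left; apply/seteqP; split=> h //; rewrite translateE.
  right; exists (g.1 + val g.2 * x), (scale_ideal (val g.2) I);
    case: (Pg) => Rb Sa.
  have Ra := R_modGamma_integer Sa.
  split; [by apply: integersD => //; exact: integersM|exact: coprime_scale|].
  by apply: translate_coset_rtimes => //; case: cI => -[].
- move=> [->|[x [I [Rx cI ->]]]].
    by left; apply/seteqP; split=> h //; rewrite pretranslateE => -[].
  have iI : is_ideal I by case: cI => -[].
  have [[y [Ry xy]] | ny] := pselect (exists y, R y /\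
    addcoset x I (g.1 + val g.2 * y)).
    right; exists y, (colon (val g.2) I); split=> //;
      last exact: pretranslate_coset_rtimes.
    by apply: coprime_colon => //; case: Pg => _; exact: R_modGamma_integer.
  left; apply/seteqP; split=> h //; rewrite pretranslateE => -[[xh _] [Rh _]].
  by apply: ny; exists h.1.
case: IX => [->|[x [I [Rx cI ->]]]]; first by left; rewrite set0I.
case: IY => [->|[y [J [Ry cJ ->]]]]; first by left; rewrite setI0.
have [iI iJ] : is_ideal I /\ is_ideal J by case: cI cJ => -[? _] _ [[? _] _].
have [[z [xz yz]] | nz] := pselect (exists z, addcoset x I z /\ addcoset y J z).
  right; exists z, (I `&` J); split; [|exact: coprime_setI|exact:
    setI_coset_rtimes].
  case: xz => t It <-; apply: integersD => //; case: iI => IR _ _ _; exact: IR.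
left; apply/seteqP; split=> g // [[xg _] [yg _]]; apply: nz; by exists g.1.
Qed.

(** Write [1] as a sum of products [u * y] with [u] in [I] and [y] in the
    inverse of [I]. If [x (d y)] is in [d R] for all these [y], then [x] is in
    [I]. As [d] is [1] modulo [m0], the integers [d y] are congruent modulo
    [d R] to elements that are [1] modulo [m0] as well, hence to elements of
    the monoid. *)
Lemma ideal_divisorial I d : nonzero_ideal I -> I d -> S d -> m0 (d - 1) ->
  exists2 cs : seq K, {in cs, forall c, S c} &
    I = [set x | R x /\ {in cs, forall c, scale_ideal d R (c * x)}].
Proof.
move=> nI Id Sd md; case: (nI) => iI _; case: (iI) => IR I0 ID IM.
have Rd := R_modGamma_integer Sd; have d0 := R_modGamma_neq0 Sd.
have idR : is_ideal (scale_ideal d R) by apply: scale_ideal_ideal => //;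
  exact: integers_ideal.
have dRd r : R r -> scale_ideal d R (d * r) by move=> Rr; exists r.
have ndR : nonzero_ideal (scale_ideal d R).
  by apply: nonzero_idealI (dRd _ (integers1 K)) _ => //; rewrite mulr1.
have im := mod_zero_ideal m; have [mR m00 mD mM] := im;
  have [_ dR0 dRD dRM] := idR.
have [N N0 dmN] := nonzero_ideal_nat (nonzero_mul_ideal ndR (mod_zero_nonzero
  m)).
have dN : scale_ideal d R N%:R by exact: ideal_mul_subl dmN.
have mN : m0 N%:R by exact: ideal_mul_subr dmN.
pose good z := exists cs : seq K, [/\ {in cs, forall c, S c},
  forall x, I x -> {in cs, forall c, scale_ideal d R (c * x)} &
  forall x, R x -> {in cs, forall c, scale_ideal d R (c * x)} -> I (x * z)].
suff [cs [Scs Ics csI]] : good 1.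
  exists cs => //; apply/seteqP; split=> [x Ix|x [Rx csx]]; first by split;
    [exact: IR|exact: Ics].
  by rewrite -[x]mulr1; exact: csI.
elim/ideal_mul_ind: 1 / (ideal_invertible nI) => [|y z|u y Iu Iy].
- by exists [::]; split=> // x _ _; rewrite mulr0.
- move=> [cs [Scs Ics csI]] [cs' [Scs' Ics' csI']]; exists (cs ++ cs').
  split=> [c|x Ix c|x Rx csx]; rewrite ?mem_cat.
  + by case/orP; [exact: Scs|exact: Scs'].
  + by case/orP; [exact: Ics|exact: Ics'].
  + rewrite mulrDr; apply: ID; [apply: csI|apply: csI'] => // c cc; apply: csx;
      by rewrite mem_cat cc ?orbT.
have Rdy : R (d * y) by exact: Iy.
have mb : m0 (d * y * (1 - d)).
  by apply: mM => //; rewrite -opprB; exact: idealN.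
have [||t Rt Sc] := R_modGamma_shift gGamma (a :=
  d + d * y * (1 - d)) _ _ N0 mN.
- by apply: integersD => //; exact: mR.
- by rewrite addrAC; exact: mD.
(* [c] is congruent to [d y] modulo [d R]. *)
set c := d + _ + _ in Sc.
exists [:: c]; split=> [_ /[!inE] /eqP -> //|x Ix _ /[!inE] /eqP ->|x Rx csx].
  have -> : c * x = d * (x + (x * y) * (1 - d)) + (t * x) * N%:R by rewrite /c;
    ring.
  have Rx := IR _ Ix; apply: dRD; last by apply: dRM => //; exact: integersM.
  apply: dRd; apply: integersD => //; apply: integersM; first exact: Iy.
  by apply: integersB => //; exact: integers1.
have [r Rr e] : scale_ideal d R (d * y * x).
  have -> : d * y * x = (c * x - (t * x) * N%:R) + d * (d * y * x - x)
    by rewrite /c; ring.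
  apply: dRD; last by apply: dRd; apply: integersB => //; exact: integersM.
  apply: idealB => //; last by apply: dRM => //; exact: integersM.
  by apply: csx; rewrite mem_head.
have {}e : r = y * x by apply: (mulfI d0); rewrite e mulrA.
have -> : x * (u * y) = r * u by rewrite e; ring.
exact: IM.
Qed.

(** The ideal [{x | c x in d R}] comes from the pretranslate by [(0, c)] of the
    translate of the semigroup by [(0, d)]. *)
Lemma constructible_divisorial d (cs : seq K) : S d -> {in cs, forall c, S c} ->
  constructible P (coset_rtimes Gamma 0
    [set x | R x /\ {in cs, forall c, scale_ideal d R (c * x)}]).
Proof.
move=> Sd; elim: cs => [|c cs IH] Scs.
  have -> : [set x | R x /\ {in [::], forall c, scale_ideal d R (c * x)}] = R.
    by apply/seteqP; split=> x => [[]|].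
  by rewrite coset_rtimes_full; exact: constructible_full.
have Sc : S c by apply: Scs; rewrite mem_head.
have -> : [set x | R x /\ {in c :: cs, forall c, scale_ideal d R (c * x)}] =
    colon c (scale_ideal d R) `&` [set x | R x /\
      {in cs, forall c, scale_ideal d R (c * x)}].
  apply/seteqP; split=> x.
    move=> [Rx csx]; split; first by split=> //; apply: csx; rewrite mem_head.
    by split=> // e ecs; apply: csx; rewrite inE ecs orbT.
  by move=> [[Rx cx] [_ csx]]; split=> // e; rewrite inE => /orP[/eqP ->|/csx].
have Pa a (Sa : S a) : P (affine_of (R_modGamma_neq0 Sa) 0) by split=> //;
  exact: integers0.
have idR : is_ideal (scale_ideal d R).
  by apply: scale_ideal_ideal; [exact: R_modGamma_integer Sd|exact:
    integers_ideal].
have [_ dR0 _ _] := idR.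
have c1 : constructible P (coset_rtimes Gamma 0 (scale_ideal d R)).
  have := translate_coset_rtimes 0 (Pa d Sd) (integers_ideal K).
  rewrite coset_rtimes_full /= mulr0 addr0 => <-.
  by apply: constructible_translate; [exact: Pa|exact: constructible_full].
have c2 : constructible P (coset_rtimes Gamma 0 (colon c (scale_ideal d R))).
  rewrite -(pretranslate_coset_rtimes (x := 0) (Pa c Sc)) //.
  - by apply: constructible_pretranslate => //; exact: Pa.
  - exact: integers0.
  - by apply/addcosetE; rewrite /= mulr0 addr0 subr0.
have c3 : constructible P (coset_rtimes Gamma 0
    [set x | R x /\ {in cs, forall c, scale_ideal d R (c * x)}]).
  by apply: IH => e ecs; apply: Scs; rewrite inE ecs orbT.
have := constructible_setI c2 c3; congr (constructible P _).
by apply/seteqP; split=> g; rewrite /setI /= !coset_rtimesE => -[];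
  [move=> [? ? ?] [? ? ?]|move=> [? ?] [? ?] ?].
Qed.

Lemma coset_rtimes_constructible x I : R x -> coprime_ideal I ->
  constructible P (coset_rtimes Gamma x I).
Proof.
move=> Rx cI; have [nI _] := cI; have [iI [d [Id Sd md]]] :=
  (coprime_idealE gGamma I).1 cI.
have c0 : constructible P (coset_rtimes Gamma 0 I).
  have [cs Scs ->] := ideal_divisorial nI Id Sd md;
    exact: constructible_divisorial.
have Px : P (affine_of (oner_neq0 K) x) by split=> //; exact: R_modGamma1.
have := constructible_translate Px c0; rewrite translate_coset_rtimes //= mulr0
  addr0.
congr (constructible P (coset_rtimes Gamma x _)).
by apply/seteqP; split=> [y [z Iz <-]|y Iy]; [rewrite mul1r|exists y;
  rewrite ?mul1r].
Qed.

(** * The isomorphism and independence *)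

(** The ideal of a coset [C] is recovered as the set of translations
    preserving [C], so that no choice of a representative is needed. *)
Definition coset_to_constructible (C : set K) : set (affine K) :=
  [set g | [/\ C g.1, S (val g.2) & forall c, C c -> C (c + val g.2)]].

Lemma coset_to_constructibleE x I : is_ideal I ->
  coset_to_constructible (addcoset x I) = coset_rtimes Gamma x I.
Proof.
move=> [IR I0 ID IM]; apply/seteqP; split=> g; rewrite coset_rtimesE.
  move=> [/addcosetE Ig Sg Cg]; split=> //.
  have /Cg/addcosetE : addcoset x I x by apply/addcosetE; rewrite subrr.
  by rewrite addrC addKr.
move=> [Ig Ia Sg]; split=> //; first exact/addcosetE.
by move=> c /addcosetE Ic; apply/addcosetE; rewrite addrAC; exact: ID.
Qed.

Lemma coset_to_constructible0 : coset_to_constructible set0 = set0.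
Proof. by apply/seteqP; split=> g // -[]. Qed.

Lemma coset_rtimes_inhabited x I b : coprime_ideal I -> addcoset x I b ->
  exists2 g, coset_rtimes Gamma x I g & g.1 = b.
Proof.
move=> /(coprime_idealE gGamma)[iI [a [Ia Sa _]]] xb.
by exists (affine_of (R_modGamma_neq0 Sa) b).
Qed.

Lemma coset_to_constructible_sub C D : cosets_or_empty m C ->
  coset_to_constructible C `<=` coset_to_constructible D -> C `<=` D.
Proof.
move=> [->|[x [I [Rx cI ->]]]]; first by move=> _ ?.
rewrite coset_to_constructibleE; last by case: cI => -[].
by move=> CD b /(coset_rtimes_inhabited cI)[g /CD[Dg _ _] <-].
Qed.

Lemma cosets_or_empty_setI C D :
  cosets_or_empty m C -> cosets_or_empty m D -> cosets_or_empty m (C `&` D).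
Proof.
move=> [->|[x [I [Rx cI ->]]]]; first by left; rewrite set0I.
move=> [->|[y [J [Ry cJ ->]]]]; first by left; rewrite setI0.
have [iI iJ] : is_ideal I /\ is_ideal J by case: cI cJ => -[? _] _ [[? _] _].
have [[z [xz yz]] | nz] := pselect (exists z, addcoset x I z /\ addcoset y J z).
  right; exists z, (I `&` J); split; [|exact: coprime_setI|].
    by case: xz => t It <-; apply: integersD => //; case: iI => IR _ _ _;
      exact: IR.
  rewrite (addcoset_eq iI xz) (addcoset_eq iJ yz); apply/seteqP; split=> u.
    by move=> [/addcosetE ? /addcosetE ?]; exact/addcosetE.
  by move=> /addcosetE[? ?]; split; exact/addcosetE.
left; apply/seteqP; split=> u // [xu yu]; apply: nz; by exists u.
Qed.

Lemma coset_to_constructible_setI C D : cosets_or_empty m C ->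
  cosets_or_empty m D ->
  coset_to_constructible (C `&` D) =
    coset_to_constructible C `&` coset_to_constructible D.
Proof.
move=> [->|[x [I [Rx cI ->]]]]; first
  by rewrite !(set0I, coset_to_constructible0).
move=> [->|[y [J [Ry cJ ->]]]]; first
  by rewrite !(setI0, coset_to_constructible0).
have [iI iJ] : is_ideal I /\ is_ideal J by case: cI cJ => -[? _] _ [[? _] _].
apply/seteqP; split=> g; last first.
  by move=> [[Cg Sg C1] [Dg _ D1]]; split=> // c [Cc Dc]; split;
    [exact: C1|exact: D1].
move=> [[xg yg] Sg CD]; have [/addcosetE CDI /addcosetE CDJ] :=
  CD _ (conj xg yg).
have [/addcosetE Ig /addcosetE Jg] := (xg, yg).
rewrite !coset_to_constructibleE //; split; apply/coset_rtimesE; split=> //.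
  have -> : val g.2 = (g.1 + val g.2 - x) - (g.1 - x) by ring.
  exact: idealB.
have -> : val g.2 = (g.1 + val g.2 - y) - (g.1 - y) by ring.
exact: idealB.
Qed.

Lemma coset_to_constructible_iso :
  semilattice_iso (cosets_or_empty m) setI (constructible P) setI
    coset_to_constructible.
Proof.
split; last exact: coset_to_constructible_setI.
split=> [C|C D|X].
- move=> [->|[x [I [Rx cI ->]]]].
    by rewrite coset_to_constructible0; exact: constructible_empty.
  rewrite coset_to_constructibleE; last by case: cI => -[].
  exact: coset_rtimes_constructible.
- rewrite !inE => mC mD CD.
  by apply/seteqP; split; apply: coset_to_constructible_sub => //; rewrite CD.
move=> /constructible_coset [->|[x [I [Rx cI ->]]]].
  by exists set0; [left|exact: coset_to_constructible0].
exists (addcoset x I); first by right; exists x, I.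
by rewrite coset_to_constructibleE //; case: cI => -[].
Qed.

Lemma coset_rtimes_sub x y I J : coprime_ideal I -> coprime_ideal J ->
  coset_rtimes Gamma y J `<=` coset_rtimes Gamma x I ->
  J `<=` I /\ addcoset x I y.
Proof.
move=> cI cJ sub; have [[iI _] _] := cI; have [[iJ _] _] := cJ.
have [JR J0 _ _] := iJ.
have in_xI b : J (b - y) -> I (b - x).
  move=> /addcosetE /(coset_rtimes_inhabited cJ)[g /sub].
  by rewrite coset_rtimesE => -[Ig _ _] <-.
have Iyx : I (y - x) by apply: in_xI; rewrite subrr.
split; last exact/addcosetE.
move=> z Jz; have -> : z = (y + z - x) - (y - x) by ring.
by apply: idealB => //; apply: in_xI; rewrite addrC addKr.
Qed.

(** A nonempty member different from the union has its ideal inside [I p] for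
    some maximal ideal [p]. An element [a] of [I] avoiding these finitely many
    products gives a point [(x, a)] outside all members of the family. *)
Lemma constructible_independent : independent (constructible P).
Proof.
move=> n X Y /constructible_coset cX cY YX.
have YsubX i : Y i `<=` X by rewrite -YX => g Yg; exists i.
case: cX => [X0|[x [I [Rx cI XE]]]].
  exists ord0; rewrite X0; apply/seteqP; split=> // g /YsubX; by rewrite X0.
apply: contrapT => neY.
have [[iI _] _] := cI; have nI : nonzero_ideal I by case: cI.
have proper i : Y i !=set0 -> exists2 p, maximal_ideal p &
    forall g, Y i g -> ideal_mul I p (val g.2).
  move=> [g0 Yg0]; have [Y0|[y [J [Ry cJ YE]]]] := constructible_coset (cY i).
    by move: Yg0; rewrite Y0.
  have [JI xy] : J `<=` I /\ addcoset x I y.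
    by apply: coset_rtimes_sub => //; rewrite -XE -YE.
  have [|p mp Jp] := proper_sub_mul_maximal nI (proj1 cJ) JI.
    by move=> JE; apply: neY; exists i; rewrite XE YE JE /coset_rtimes
      (addcoset_eq iI xy).
  by exists p => // g; rewrite YE coset_rtimesE => -[_ /Jp].
have [g0 Xg0] : X !=set0.
  have /(coset_rtimes_inhabited cI)[g xg _] : addcoset x I x.
    by apply/addcosetE; rewrite subrr; case: iI.
  by exists g; rewrite XE.
have [i0 _ Yi0] : (\bigcup_i Y i) g0 by rewrite YX.
have [p0 mp0 _] : exists2 p, maximal_ideal p & forall g, Y i0 g ->
  ideal_mul I p (val g.2).
  by apply: proper; exists g0.
(* Indices of empty members, and those beyond [n], get the arbitrary [p0]. *)
have /choice[p pP] : forall k : nat, exists p, maximal_ideal p /\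
    forall i : 'I_n.+1, i = k :> nat -> forall g, Y i g ->
      ideal_mul I p (val g.2).
  move=> k; have [kn | kn] := ltnP k n.+1; last first.
    by exists p0; split=> // i ik; move: (ltn_ord i); rewrite ik ltnNge kn.
  have [/proper[p mp Yp] | Yk] := pselect (Y (Ordinal kn) !=set0).
    by exists p; split=> // i ik; have -> : i = Ordinal kn by exact: val_inj.
  exists p0; split=> // i ik g; have -> : i = Ordinal kn by exact: val_inj.
  by move=> Yg; case: Yk; exists g.
have [a [Ia Sa an]] := avoid_maximal gGamma n.+1 cI (fun k => proj1 (pP k)).
have Xg : X (affine_of (R_modGamma_neq0 Sa) x).
  by rewrite XE coset_rtimesE /= subrr; split=> //; case: iI.
rewrite -YX in Xg; case: Xg => i _ Yg.
exact: (an i (ltn_ord i) (proj2 (pP i) i erefl _ Yg)).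
Qed.

End AffineConstructible.

Theorem proposition3p4 (RR : realType) (K : fieldExtType rat)
    (m : modulus RR K) (Gamma : set (residue m)) :
  residue_subgroup Gamma ->
  [/\ is_semilattice (cosets_or_empty m) setI,
      forall (x : K) (I : set K),
        integers K x -> coprime_integral_ideals m I ->
        constructible (R_rtimes_R_modGamma Gamma) (coset_rtimes Gamma x I),
      exists phi : set K -> set (affine K),
        [/\ forall (x : K) (I : set K),
              integers K x -> coprime_integral_ideals m I ->
              phi (addcoset x I) = coset_rtimes Gamma x I,
            phi set0 = set0
          & semilattice_iso (cosets_or_empty m) setI
              (constructible (R_rtimes_R_modGamma Gamma)) setI phi]
    & independent (constructible (R_rtimes_R_modGamma Gamma))].
Proof.
move=> gGamma; split.
- split=> [C D|C D E _ _ _|C D _ _|C _]; last exact: setIid.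
  + exact: (cosets_or_empty_setI gGamma).
  + exact: setIA.
  + exact: setIC.
- by move=> x I; exact: coset_rtimes_constructible.
- exists (coset_to_constructible Gamma); split.
  + by move=> x I _ [[iI _] _]; exact: coset_to_constructibleE.
  + exact: coset_to_constructible0.
  + exact: coset_to_constructible_iso.
- exact: constructible_independent.
Qed.
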